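(* Let $X\sim\mathcal N_k(\theta,I_k)$ with $\theta\in\mathbb R^k$ unknown, to be estimated under the loss $L(\theta,\delta)=\|\delta-\theta\|^2$. Assume that the prior on $\theta$ is a variance mixture of normal distributions with mixing density $h$. 1. A sufficient condition for the corresponding spherical (generalized) Bayes estimator of the mean $\theta$ to be minimax is $$\frac{G'(s)}{G(s)}-2\,\frac{G''(s)}{G'(s)}\le\frac ks\qquad\text{for all } s>0, \qquad(\ast)$$ where $G$ is the Laplace transform of $$f:t\mapsto t^{k/2-2}\,h\!\left(\frac{1-t}{t}\right)\mathbf 1_{]0,1[}(t).$$ 2. For any continuous function $\varphi$ such that $\varphi(s)\le k/s$ for every $s>0$, the function $G$ defined, for any $s>0$, by $$G(s)=\left(\int_b^s\exp\!\left(-\frac12\int_a^t\varphi(u)\,du\right)dt\right)^2,$$ where $a$ and $b$ are two real constants, satisfies $(\ast)$. Provided that the function $G$ obtained is the Laplace transform of a positive function defined on $]0,\infty[$ and vanishing outside $]0,1[$, the mixing density $h$ is given, for every $v>0$, by $$h(v)=(v+1)^{k/2-2}\,\mathcal L^{-1}[G]\!\left(\frac1{v+1}\right),$$ where $\mathcal L^{-1}$ is the inverse Laplace transform. If, in addition, the function $h$ is integrable, then the resulting proper Bayes estimator is minimax.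
   Context: Variance mixture of normals with mixing density $h$ on $(0,\infty)$: the (possibly generalized, i.e. improper) prior has density $\pi(\theta)=\int_0^\infty(2\pi v)^{-k/2}\exp\!\left(-\frac{\|\theta\|^2}{2v}\right)h(v)\,dv$ on $\mathbb R^k$. The prior is proper if $h$ is integrable (up to normalization by a constant, which does not affect the Bayes estimator). Marginal: $m(x)=(2\pi)^{-k/2}\int_{\mathbb R^k}\exp(-\tfrac12\|x-\theta\|^2)\,\pi(\theta)\,d\theta$. The (generalized) Bayes estimator is $\delta_\pi(X)=X+\nabla\log m(X)$. Risk: $R(\theta,\delta)=E_\theta\|\delta(X)-\theta\|^2$. An estimator $\delta$ is minimax if $\sup_\theta R(\theta,\delta)=\inf_{\delta'}\sup_\theta R(\theta,\delta')$; this minimax value equals $k$, the constant risk of the usual estimator $\delta_0(X)=X$. Laplace transform: $G(s)=\int_0^\infty e^{-st}f(t)\,dt$ for $s>0$; $\mathcal L^{-1}[G]$ denotes the function on $]0,\infty[$ whose Laplace transform is $G$. $\mathbf 1_{]0,1[}$ is the indicator function of the open interval $]0,1[$. *)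

(* Defs.v *)
From HB Require Import structures.
From mathcomp Require Import all_boot all_order all_algebra.
From mathcomp Require Import all_classical all_reals all_analysis.

Set Implicit Arguments.
Unset Strict Implicit.
Unset Printing Implicit Defensive.

Import Order.TTheory GRing.Theory Num.Theory.
Import numFieldNormedType.Exports.

Local Open Scope classical_set_scope.
Local Open Scope ring_scope.

Definition rV_display : measure_display.
Proof. exact: default_measure_display. Qed.

(* R^n carries the sigma-algebra generated by the coordinate maps. *)
Section measurable_rV.
Context {R : realType} {n : nat}.

Let coord (i : 'I_n) (x : 'rV[R]_n) : R := x 0 i.

Let rV_set0 : g_sigma_preimage coord set0.
Proof. exact: sigma_algebra0. Qed.

Let rV_setC A : g_sigma_preimage coord A -> g_sigma_preimage coord (~` A).
Proof. exact: sigma_algebraC. Qed.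

Let rV_bigcup (F : (set 'rV[R]_n)^nat) :
  (forall i, g_sigma_preimage coord (F i)) ->
  g_sigma_preimage coord (\bigcup_i F i).
Proof. exact: sigma_algebra_bigcup. Qed.

HB.instance Definition _ := @isMeasurable.Build rV_display
  'rV[R]_n (g_sigma_preimage coord) rV_set0 rV_setC rV_bigcup.

Lemma measurable_coord (i : 'I_n) :
  measurable_fun [set: 'rV[R]_n] (fun x : 'rV[R]_n => x 0 i : R).
Proof.
move=> _ Y mY; rewrite setTI; apply: sub_sigma_algebra => /=.
rewrite -bigcup_seq/=; exists i => /=; first by rewrite mem_index_enum.
by exists Y => //; rewrite setTI.
Qed.

Lemma measurable_rVP d (T : measurableType d) (f : T -> 'rV[R]_n) :
  (forall i, measurable_fun setT (fun t => f t 0 i : R)) ->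
  measurable_fun setT f.
Proof.
move=> mf; apply: (@iffLR (g_sigma_preimage (fun i => coord i \o f) `<=`
  measurable)).
  rewrite g_sigma_preimage_comp; split=> [prefS|fm A [/= C preC <-]].
    by move=> _ A mA; apply: prefS; exists A.
  exact: fm.
apply: smallest_sub; first exact: sigma_algebra_measurable.
rewrite -bigcup_seq => A [i _] [B mB <-].
exact: mf.
Qed.

End measurable_rV.

Section lebesgue_cons.
Context {R : realType} {n : nat}.

Definition rV_cons (p : R * 'rV[R]_n) : 'rV[R]_n.+1 :=
  row_mx (p.1%:M : 'rV[R]_1) p.2.

Definition rV_uncons (x : 'rV[R]_n.+1) : R * 'rV[R]_n :=
  (x 0 0, \row_j x 0 (lift ord0 j)).

Lemma rV_cons0 p : rV_cons p 0 0 = p.1.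
Proof.
have -> : 0 = lshift n 0 :> 'I_(1 + n) by exact/val_inj.
by apply: etrans (row_mxEl _ _ _ _) _; rewrite mxE eqxx mulr1n.
Qed.

Lemma rV_consS p j : rV_cons p 0 (lift ord0 j) = p.2 0 j.
Proof.
have -> : lift ord0 j = rshift 1 j :> 'I_(1 + n) by exact/val_inj.
exact: (row_mxEr _ _ _ _).
Qed.

Lemma rV_consK : cancel rV_cons rV_uncons.
Proof.
move=> [a x]; rewrite /rV_uncons rV_cons0; congr pair.
by apply/rowP => j; rewrite mxE rV_consS.
Qed.

Lemma measurable_rV_cons : measurable_fun setT rV_cons.
Proof.
apply: measurable_rVP => i; have [j ->|->] := unliftP ord0 i.
  under eq_fun do rewrite rV_consS.
  by apply: (measurableT_comp (measurable_coord j)); exact: measurable_snd.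
under eq_fun do rewrite rV_cons0.
exact: measurable_fst.
Qed.

Lemma measurable_rV_uncons : measurable_fun setT rV_uncons.
Proof.
apply/measurable_fun_pair; first exact: measurable_coord.
apply: measurable_rVP => i; under eq_fun do rewrite mxE.
exact: measurable_coord.
Qed.

Variable mu : {sigma_finite_measure set 'rV[R]_n -> \bar R}.

Definition lebesgue_cons : set 'rV[R]_n.+1 -> \bar R :=
  pushforward (@lebesgue_measure R \x mu)%E rV_cons.

Let lebesgue_cons0 : lebesgue_cons set0 = 0%E.
Proof. by rewrite /lebesgue_cons /pushforward preimage_set0 measure0. Qed.

Let lebesgue_cons_ge0 A : (0 <= lebesgue_cons A)%E.
Proof. by apply: integral_ge0 => x _; exact: measure_ge0. Qed.

Let lebesgue_cons_sigma_additive : semi_sigma_additive lebesgue_cons.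
Proof.
have mf := measurable_rV_cons.
move=> F mF tF mUF; rewrite /lebesgue_cons /pushforward preimage_bigcup.
apply: measure_semi_sigma_additive.
- by move=> i; rewrite -[X in measurable X]setTI; exact: mf.
- apply/trivIsetP => /= i j _ _ ij; rewrite -preimage_setI.
  by move/trivIsetP : tF => /(_ _ _ _ _ ij) ->//; rewrite preimage_set0.
- by rewrite -preimage_bigcup -[X in measurable X]setTI; exact: mf.
Qed.

HB.instance Definition _ := isMeasure.Build _ _ _ lebesgue_cons
  lebesgue_cons0 lebesgue_cons_ge0 lebesgue_cons_sigma_additive.

Let lebesgue_cons_sigma_finite : sigma_finite setT lebesgue_cons.
Proof.
have /sigma_finiteP[F [FT ndF Foo]] := sigma_finiteT (@lebesgue_measure R).
have /sigma_finiteP[G [GT ndG Goo]] := sigma_finiteT mu.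
exists (fun i => rV_uncons @^-1` (F i `*` G i)).
  rewrite -preimage_bigcup; apply/esym; rewrite -subTset => x _ /=.
  have [i _ Fi] : (\bigcup_i F i) (x 0 0) by rewrite -FT.
  have [j _ Gj] : (\bigcup_i G i) (rV_uncons x).2 by rewrite -GT.
  exists (maxn i j) => //; split.
    by move: Fi; exact/subsetPset/ndF/leq_maxl.
  by move: Gj; exact/subsetPset/ndG/leq_maxr.
move=> i; have [mF Fy] := Foo i; have [mG Gy] := Goo i.
have mFG : measurable (F i `*` G i) by exact: measurableX.
split; first by rewrite -[_ @^-1` _]setTI; exact: measurable_rV_uncons.
rewrite /lebesgue_cons /pushforward -comp_preimage.
rewrite (_ : _ \o _ = id); last by apply/funext => p; exact: rV_consK.
by rewrite preimage_id product_measure1E// lte_mul_pinfty// ge0_fin_numE.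
Qed.

HB.instance Definition _ := Measure_isSigmaFinite.Build _ _ _ lebesgue_cons
  lebesgue_cons_sigma_finite.

End lebesgue_cons.

(* Lebesgue measure on R^n: the n-fold product of the one on R. *)
Fixpoint lebesgue_rV {R : realType} (n : nat) :
    {sigma_finite_measure set 'rV[R]_n -> \bar R} :=
  match n with
  | 0 => \d_(0 : 'rV[R]_0)
  | m.+1 => lebesgue_cons (lebesgue_rV m)
  end.

Lemma lebesgue_rV_box (R : realType) n (A : 'I_n -> set R) :
  (forall i, measurable (A i)) ->
  lebesgue_rV n [set x : 'rV[R]_n | forall i, A i (x 0 i)] =
  (\prod_(i < n) lebesgue_measure (A i))%E.
Proof.
elim: n => [|n IH] in A *; move=> mA.
  by rewrite big_ord0 /= diracE mem_set//= => -[].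
rewrite big_ord_recl /= /lebesgue_cons /pushforward.
rewrite -IH//.
rewrite -product_measure1E; last 2 first.
- exact: mA.
- rewrite (_ : mkset _ =
      \big[setI/setT]_i ((fun x : 'rV[R]_n => x 0 i) @^-1` A (lift ord0 i))).
    apply: bigsetI_measurable => i _; rewrite -[_ @^-1` _]setTI.
    exact: measurable_coord.
  rewrite -bigcap_seq; apply/seteqP; split => x /= Ax.
    by move=> i _; exact: Ax.
  by move=> i; apply: Ax; rewrite /= mem_index_enum.
congr (product_measure1 _ _ _); apply/seteqP; split => -[a x] /=.
  move=> Ax; split; first by have := Ax ord0; rewrite rV_cons0.
  by move=> i; have := Ax (lift ord0 i); rewrite rV_consS.
move=> [Aa Ax] i; have [j ->|->] := unliftP ord0 i.
  by rewrite rV_consS; exact: Ax.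
by rewrite rV_cons0.
Qed.

Section normal_mean_estimation.
Context {R : realType}.
Notation mu := (@lebesgue_measure R).

Section estimators.
Context {k : nat}.
Implicit Types (x theta : 'rV[R]_k) (h : R -> R) (delta : 'rV[R]_k -> 'rV[R]_k).

(* Squared Euclidean norm (the library's norm on row vectors is the sup norm) *)
Definition sqnorm x : R := \sum_(i < k) x 0 i ^+ 2.

(* Density of N_k(theta, v I_k) *)
Definition normal_density theta (v : R) x : R :=
  (2 * pi * v) `^ (- (k%:R / 2)) * expR (- (sqnorm (x - theta) / (2 * v))).

(* E_theta ||delta(X) - theta||^2 for X ~ N_k(theta, I_k) *)
Definition risk delta theta : \bar R :=
  (\int[lebesgue_rV k]_x
    (normal_density theta 1 x * sqnorm (delta x - theta))%:E)%E.

Definition max_risk delta : \bar R := ereal_sup (range (risk delta)).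

Definition minimax delta : Prop :=
  measurable_fun setT delta /\
  max_risk delta = ereal_inf
    [set max_risk delta' | delta' in
      [set delta' : 'rV[R]_k -> 'rV[R]_k | measurable_fun setT delta']].

(* Both may be infinite at some points, for instance at the origin. *)
Definition mixture_prior h theta : \bar R :=
  (\int[mu]_(v in `]0%R, +oo[) (normal_density 0 v theta * h v)%:E)%E.

Definition marginal h x : \bar R :=
  (\int[lebesgue_rV k]_theta
    ((normal_density theta 1 x)%:E * mixture_prior h theta))%E.

Definition gradient (F : 'rV[R]_k -> R) x : 'rV[R]_k :=
  \row_(i < k) 'D_(delta_mx 0 i) F x.

Definition bayes_estimator h x : 'rV[R]_k :=
  x + gradient (fun y => ln (fine (marginal h y))) x.

Definition proper_prior h : Prop :=
  (0 < \int[lebesgue_rV k]_theta mixture_prior h theta < +oo)%E.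

End estimators.

(* A mixing density need not be integrable, and is not almost everywhere zero. *)
Definition mixing_density (h : R -> R) : Prop :=
  [/\ measurable_fun (`]0, +oo[ : set R) h,
      forall v : R, 0 < v -> 0 <= h v &
      (0 < \int[mu]_(v in `]0%R, +oo[) (h v)%:E)%E].

Definition is_laplace_transform (f G : R -> R) : Prop :=
  forall s : R, 0 < s ->
    mu.-integrable `]0, +oo[ (EFin \o (fun t => expR (- s * t) * f t)) /\
    \int[mu]_(t in `]0, +oo[) (expR (- s * t) * f t) = G s.

Definition laplace_density (k : nat) (h : R -> R) (t : R) : R :=
  t `^ (k%:R / 2 - 2) * h ((1 - t) / t) * \1_`]0, 1[ t.

Definition mixing_of_laplace_density (k : nat) (f : R -> R) (v : R) : R :=
  (v + 1) `^ (k%:R / 2 - 2) * f (1 / (v + 1)).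

(* Division by zero yields zero, so the inequality holds trivially at a zero of
   both G and G'. *)
Definition minimaxity_condition (k : nat) (G : R -> R) : Prop :=
  forall s : R, 0 < s ->
    G^`()%classic s / G s - 2 * (G^`(2)%classic s / G^`()%classic s)
      <= k%:R / s.

Definition open_between (x y : \bar R) : set R := [set t | x < t%:E < y]%E.

(* The integral of f from x to y, with the sign changed when y < x; the
   endpoints may be infinite. *)
Definition oriented_integral (x y : \bar R) (f : R -> R) : R :=
  \int[mu]_(t in open_between x y) f t - \int[mu]_(t in open_between y x) f t.

Definition integrable_between (x y : \bar R) (f : R -> R) : Prop :=
  mu.-integrable (open_between x y `|` open_between y x) (EFin \o f).

Definition inner_exp (phi : R -> R) (a t : R) : R :=
  expR (- (1 / 2) * oriented_integral a%:E t%:E phi).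

Definition squared_primitive (phi : R -> R) (a : R) (b : \bar R) (s : R) : R :=
  oriented_integral b s%:E (inner_exp phi a) ^+ 2.

(* All the integrals that define squared_primitive phi a b s for s > 0 converge.
   This always holds for phi continuous on ]0, +oo[ and a, b in ]0, +oo[. *)
Definition squared_primitive_defined (phi : R -> R) (a : R) (b : \bar R) : Prop :=
  forall s : R, 0 < s ->
    (forall t, (open_between b s%:E `|` open_between s%:E b) t ->
      integrable_between a%:E t%:E phi) /\
    integrable_between b s%:E (inner_exp phi a).

End normal_mean_estimation.

(* Main.v *)
(* Writing t = 1 / (1 + v), the marginal is m(x) = (2 pi)^(-k/2) G(|x|^2 / 2), and
   since f lives on ]0, 1[, G extends to a smooth positive function on the whole
   line with 0 <= - G' <= G and 0 <= G'' <= G. Hence the Bayes estimator is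
   x + psi(|x|^2 / 2) x, where psi = G' / G takes its values in [-1, 0] and has a
   bounded derivative. By Stein's identity its risk is at most k as soon as
   2 k psi + 4 s psi' + 2 s psi^2 <= 0, which is the minimaxity condition
   multiplied by 2 s psi. Conversely no estimator has a maximal risk below k: its
   Bayes risk under the prior N(0, v I) is at least k v / (1 + v), which tends
   to k.

   For the second part put U(s) = \int_b^s exp(- 1/2 \int_a^t phi), so that
   G = U^2 and U'' = - phi U' / 2; then G' / G - 2 G'' / G' = phi. The mixing
   density is determined by G because the Laplace transform is injective: a
   function whose transform vanishes is orthogonal to the polynomials in
   exp(- t), and (1 - exp(- n t))^(floor (exp (n T))) tends to the indicator of
   t > T. *)
Require Import Defs.
From mathcomp Require Import all_boot all_order all_algebra.
From mathcomp Require Import all_classical all_reals all_analysis.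
From mathcomp Require Import measurable_realfun ring lra.

Set Implicit Arguments.
Unset Strict Implicit.
Unset Printing Implicit Defensive.

Import Order.TTheory GRing.Theory Num.Theory.
Import numFieldNormedType.Exports.

Local Open Scope classical_set_scope.
Local Open Scope ring_scope.

(** * Integration on row vectors *)

(** The inverse Laplace transform is never formed: [f] is any nonnegative function on []0, 1[] with
    transform [G], and the uniqueness of the mixing density up to null sets is proved separately.
    The transform is known for [s > 0] only, whereas the estimator at [x = 0] involves [s = 0];
    since [exp(- s t)] is bounded on []0, 1[], the integral makes sense for all real [s] and can be
    differentiated under the integral sign. A mixing density is merely measurable, so the
    substitution between [v] and [t] must hold without continuity: it is obtained by comparing two
    measures on rays. Stein's identity is proved one coordinate at a time: along a line parallel to
    an axis, the integral of a derivative vanishes when the function and its derivative are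
    dominated by a Gaussian times a quadratic, and the bounds on [psi] and its derivative supply
    that domination. In the second part [G] may vanish at [s = b], and only there, so this point is
    treated apart. *)

Section integration_rV.
Context {R : realType}.
Notation mu := (@lebesgue_measure R).

Lemma ge0_integral_rV_cons n (F : 'rV[R]_n.+1 -> \bar R) :
  measurable_fun setT F -> (forall x, 0 <= F x)%E ->
  (\int[lebesgue_rV n.+1]_x F x =
   \int[mu]_t \int[lebesgue_rV n]_x F (rV_cons (t, x)))%E.
Proof.
move=> mF F0.
transitivity (\int[pushforward (mu \x lebesgue_rV n)%E (@rV_cons R n)]_x F x)%E.
  by apply: eq_measure_integral => [|A mA _]; [exact: measurable_rV_cons|].
rewrite ge0_integral_pushforward//; last exact: measurable_rV_cons.
rewrite preimage_setT fubini_tonelli1//.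
by apply: measurableT_comp => //; exact: measurable_rV_cons.
by move=> z; exact: F0.
Qed.

Lemma integrable_rV_cons n (F : 'rV[R]_n.+1 -> \bar R) :
  (lebesgue_rV n.+1).-integrable setT F ->
  (mu \x lebesgue_rV n)%E.-integrable setT (F \o rV_cons).
Proof.
have mc := @measurable_rV_cons R n.
move=> /integrableP[mF iF]; apply/integrableP; split.
  exact: measurableT_comp.
move: iF; rewrite ge0_integral_rV_cons//; last exact: measurableT_comp.
rewrite fubini_tonelli1//.
by apply: measurableT_comp => //; exact: measurableT_comp.
Qed.

Lemma integral_rV_cons n (F : 'rV[R]_n.+1 -> \bar R) :
  (lebesgue_rV n.+1).-integrable setT F ->
  (\int[lebesgue_rV n.+1]_x F x =
   \int[(mu \x lebesgue_rV n)%E]_z F (rV_cons z))%E.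
Proof.
move=> iF.
transitivity (\int[pushforward (mu \x lebesgue_rV n)%E (@rV_cons R n)]_x F x)%E.
  by apply: eq_measure_integral => [|A mA _]; [exact: measurable_rV_cons|].
rewrite integral_pushforward//.
- exact: measurable_rV_cons.
- exact: measurable_int iF.
- by rewrite preimage_setT; exact: integrable_rV_cons.
Qed.

Lemma integral_rV0 (F : 'rV[R]_0 -> \bar R) :
  measurable_fun setT F -> (\int[lebesgue_rV 0]_x F x = F 0%R)%E.
Proof. by move=> mF; rewrite /= integral_dirac// diracT mul1e. Qed.

Lemma measurable_prod_coord n (f : 'I_n -> R -> R) :
  (forall i, measurable_fun setT (f i)) ->
  measurable_fun setT (fun x : 'rV[R]_n => \prod_(i < n) f i (x 0 i)).
Proof.
move=> mf; apply: measurable_prod => i _.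
by apply: measurableT_comp; [exact: mf|exact: measurable_coord].
Qed.

Lemma integral_rV_prod n (f : 'I_n -> R -> R) :
  (forall i, measurable_fun setT (f i)) -> (forall i t, 0 <= f i t) ->
  (\int[lebesgue_rV n]_x (\prod_(i < n) f i (x 0 i))%:E =
   \prod_(i < n) \int[mu]_t (f i t)%:E)%E.
Proof.
elim: n f => [|n IH] f mf f0.
  rewrite integral_rV0 ?big_ord0//.
  by apply/measurable_EFinP; exact: (measurable_prod_coord mf).
rewrite ge0_integral_rV_cons; last 2 first.
- apply/measurable_EFinP. exact: (measurable_prod_coord mf).
- by move=> x; rewrite lee_fin prodr_ge0.
have mf' i : measurable_fun setT (f (lift ord0 i)) by exact: mf.
pose c := (\prod_(i < n) \int[mu]_t (f (lift ord0 i) t)%:E)%E.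
transitivity (\int[mu]_t ((f ord0 t)%:E * c))%E.
  apply: eq_integral => t _; rewrite /c -IH//.
  rewrite -ge0_integralZl//; last 3 first.
  - by apply/measurable_EFinP; exact: (measurable_prod_coord mf').
  - by move=> x _; rewrite lee_fin prodr_ge0.
  - by rewrite lee_fin.
  apply: eq_integral => x _; rewrite big_ord_recl rV_cons0 EFinM/=.
  by under eq_bigr do rewrite rV_consS.
rewrite ge0_integralZr//; last 3 first.
- by apply/measurable_EFinP; exact: mf.
- by move=> t _; rewrite lee_fin.
- by apply: prode_ge0 => i _; apply: integral_ge0 => t _; rewrite lee_fin.
by rewrite big_ord_recl.
Qed.

Definition set_coord n (i : 'I_n) (t : R) (x : 'rV[R]_n) : 'rV[R]_n :=
  \row_j if j == i then t else x 0 j.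

Lemma set_coord_cons0 n t a (x : 'rV[R]_n) :
  set_coord ord0 t (rV_cons (a, x)) = rV_cons (t, x).
Proof.
apply/rowP => j; rewrite mxE; have [k ->|->] := unliftP ord0 j.
  by rewrite !rV_consS.
by rewrite !rV_cons0 eqxx.
Qed.

Lemma set_coord_consS n i t a (x : 'rV[R]_n) :
  set_coord (lift ord0 i) t (rV_cons (a, x)) = rV_cons (a, set_coord i t x).
Proof.
apply/rowP => j; rewrite mxE; have [k ->|->] := unliftP ord0 j.
  by rewrite !rV_consS mxE (inj_eq lift_inj).
by rewrite !rV_cons0.
Qed.

(** Fubini's theorem with the [i]-th coordinate integrated innermost. The measure splits off the
    first coordinate only, so the induction on the dimension peels coordinates until the [i]-th one
    comes first. *)
Lemma integral_eq0_coord n (i : 'I_n) (D : 'rV[R]_n -> \bar R) :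
  (lebesgue_rV n).-integrable setT D ->
  (forall x, \int[mu]_t D (set_coord i t x) = 0)%E ->
  (\int[lebesgue_rV n]_x D x = 0)%E.
Proof.
elim: n i D => [[]//|n IH] i D iD D0.
have iDc := integrable_rV_cons iD.
rewrite integral_rV_cons//.
have [j ij|i0] := unliftP ord0 i.
  rewrite -(integral12_prod_meas1 iDc).
  transitivity (\int[mu]_(t in setT) (cst 0 t))%E; last exact: integral0.
  apply: ae_eq_integral => //; first exact: (measurable_fubini_F iDc).
  (* Only almost every slice of an integrable function is integrable, so the induction hypothesis is
     available for almost every [t]. *)
  have := ae_integrable1 iDc; apply: filterS => t /= it _.
  apply: (IH j) => // x; rewrite -[RHS](D0 (rV_cons (t, x))).
  by apply: eq_integral => u _; rewrite ij set_coord_consS.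
rewrite -(integral21_prod_meas1 iDc).
transitivity (\int[@lebesgue_rV R n]_(x in setT) (cst 0 x))%E; last exact: integral0.
apply: eq_integral => x _; rewrite -[RHS](D0 (rV_cons (0, x))).
by apply: eq_integral => t _; rewrite i0 set_coord_cons0.
Qed.

End integration_rV.

(** * Gaussian integrals on the line *)

Section gaussian_line.
Context {R : realType}.
Notation mu := (@lebesgue_measure R).
Implicit Types (a v t : R) (f F : R -> R).

Lemma is_derive_continuous f t df : is_derive t 1 f df -> {for t, continuous f}.
Proof.
by move=> [d _]; apply/differentiable_continuous/derivable1_diffP.
Qed.

(** The fundamental theorem of calculus on [[- (n + 1), n + 1]], followed by dominated convergence
    with [|f|] as the bound. The shift to [n + 1] keeps the interval nondegenerate. *)
Lemma integral_derive_eq0 F f :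
  (forall t, is_derive t 1 F (f t)) -> continuous f ->
  mu.-integrable setT (EFin \o f) ->
  F n.+1%:R @[n --> \oo] --> 0 -> F (- n.+1%:R) @[n --> \oo] --> 0 ->
  (\int[mu]_t (f t)%:E = 0)%E.
Proof.
move=> dF cf intf Fy FNy.
have cF t : {for t, continuous F} by exact: is_derive_continuous (dF t).
pose I n : set R := [set` `[- n.+1%:R, n.+1%:R]].
pose f_ n : R -> \bar R := (EFin \o f) \_ (I n).
have mI n : measurable (I n) by exact: measurable_itv.
have mf : measurable_fun setT (EFin \o f) by exact: measurable_int intf.
have mf_ n : measurable_fun setT (f_ n).
  exact: (iffLR (measurable_restrictT (EFin \o f) (mI n)) (measurable_funTS mf)).
have f_f : {ae mu, forall t, setT t -> f_ ^~ t @ \oo --> (EFin \o f) t}.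
  apply: aeW => t _; apply: cvg_near_cst.
  exists (Num.truncn `|t|).+1 => //= n /= tn.
  rewrite /f_ patchE mem_set// /I /= in_itv/= -ler_norml ltW//.
  apply: lt_le_trans (truncnS_gt _) _.
  by rewrite ler_nat (leq_trans tn).
have f_ub : {ae mu, forall t n, setT t -> (`|f_ n t| <= (abse \o (EFin \o f)) t)%E}.
  apply: aeW => t n _ /=; rewrite /f_ patchE; case: ifPn => _ //=.
  by rewrite normr0 lee_fin.
have [_ _] := @dominated_convergence _ _ _ mu setT measurableT f_ (EFin \o f) _ mf_ mf f_f
  (integrable_abse intf) f_ub.
have -> : [sequence (\int[mu]_x f_ n x)%E]_n =
    fun n => (F n.+1%:R - F (- n.+1%:R))%:E.
  apply/funext => n.
  transitivity (\int[mu]_(t in I n) (f t)%:E)%E.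
    by rewrite [RHS]integral_mkcond.
  rewrite EFinB.
  apply: continuous_FTC2.
  - by rewrite -subr_gt0 opprK addr_gt0.
  - by apply: continuous_subspaceT => t; exact: cf.
  - split; first by move=> t _; have [] := dF t.
    + exact: (cvg_at_right_filter (cF _)).
    + exact: (cvg_at_left_filter (cF _)).
  - by move=> t _; rewrite derive1E; have [_] := dF t.
have F0 : (F n.+1%:R - F (- n.+1%:R))%:E @[n --> \oo] --> (0 : \bar R)%E.
  by apply: cvg_EFin; [exact: nearW|rewrite -[0]subr0; exact: cvgB].
move=> H; exact: (cvg_unique _ H F0).
Qed.

Notation N a v := (normal_pdf a (Num.sqrt v)).

Lemma normal_pdf_sqrtE a v t : 0 < v ->
  N a v t = normal_peak (Num.sqrt v) * expR (- ((t - a) ^+ 2 / (2 * v))).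
Proof.
move=> v0; rewrite normal_pdfE ?gt_eqF ?sqrtr_gt0// /normal_fun.
by rewrite sqr_sqrtr ?ltW// mulNr -[v *+ 2]mulr_natl.
Qed.

Lemma is_derive_normal_pdf a v t : 0 < v ->
  is_derive t 1 (N a v) (- (t - a) / v * N a v t).
Proof.
move=> v0.
have -> : N a v = fun t => normal_peak (Num.sqrt v) * expR (- ((t - a) ^+ 2 / (2 * v))).
  by apply/funext => u; rewrite normal_pdf_sqrtE.
apply: is_derive_eq; rewrite /GRing.scale /=.
by field; rewrite gt_eqF.
Qed.

(** From [1 + y <= exp y] with [y = u / (4 v)]. It lets half of a Gaussian exponent of variance [v]
    absorb a quadratic factor. *)
Lemma quad_le_expR (u v : R) : 0 < v -> 0 <= u ->
  1 + u <= (1 + 4 * v) * expR (u / (4 * v)).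
Proof.
move=> v0 u0.
apply: (@le_trans _ _ ((1 + 4 * v) * (1 + u / (4 * v)))); last first.
  by rewrite ler_pM2l ?expR_ge1Dx// addr_gt0// mulr_gt0.
have -> : (1 + 4 * v) * (1 + u / (4 * v)) = 1 + u + (4 * v + u / (4 * v)).
  by field; rewrite gt_eqF.
by rewrite lerDl addr_ge0 ?divr_ge0// mulr_ge0 ?ltW.
Qed.

(** The exponent [u / (2 v)] is split into two halves; one absorbs [1 + u], and the other is the
    exponent of a Gaussian of variance [2 v]. *)
Lemma normal_pdf_quad_bound a v t : 0 < v ->
  N a v t * (1 + (t - a) ^+ 2) <=
  (1 + 4 * v) * normal_peak (Num.sqrt v) * expR (- ((t - a) ^+ 2 / (4 * v))).
Proof.
move=> v0; rewrite normal_pdf_sqrtE//.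
set u := (t - a) ^+ 2; have u0 : 0 <= u by exact: sqr_ge0.
have -> : - (u / (2 * v)) = - (u / (4 * v)) - u / (4 * v).
  by field; rewrite gt_eqF.
rewrite expRD.
have -> : normal_peak (Num.sqrt v) * (expR (- (u / (4 * v))) * expR (- (u / (4 * v)))) *
    (1 + u) = normal_peak (Num.sqrt v) * expR (- (u / (4 * v))) *
    (expR (- (u / (4 * v))) * (1 + u)) by ring.
rewrite [leRHS]mulrAC -[leRHS]mulrA [leRHS]mulrC (mulrC (expR _) (normal_peak _)).
rewrite ler_wpM2l ?mulr_ge0 ?normal_peak_ge0 ?expR_ge0//.
by rewrite expRN mulrC ler_pdivrMr ?expR_gt0// quad_le_expR.
Qed.

Lemma integrable_normal_pdf_quad a v (f : R -> R) C : 0 < v ->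
  measurable_fun setT f ->
  (forall t, `|f t| <= C * (N a v t * (1 + (t - a) ^+ 2))) ->
  mu.-integrable setT (EFin \o f).
Proof.
move=> v0 mf fC.
have v20 : 0 < 2 * v by rewrite mulr_gt0.
pose K := `|C| * ((1 + 4 * v) * normal_peak (Num.sqrt v)).
apply: (@le_integrable _ _ _ mu setT measurableT _
  (fun t => (K / normal_peak (Num.sqrt (2 * v)))%:E * (N a (2 * v) t)%:E)%E).
- exact/measurable_EFinP.
- move=> t _ /=; rewrite lee_fin; apply: le_trans (fC t) _.
  apply: (le_trans _ (ler_norm _)).
  rewrite (normal_pdf_sqrtE _ _ v20) [leRHS]mulrA divfK; last first.
    by rewrite gt_eqF// normal_peak_gt0// gt_eqF ?sqrtr_gt0.
  have -> : 2 * (2 * v) = 4 * v by ring.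
  rewrite -mulrA; apply: (@le_trans _ _ (`|C| * (N a v t * (1 + (t - a) ^+ 2)))).
    by rewrite ler_wpM2r ?ler_norm// mulr_ge0 ?normal_pdf_ge0// addr_ge0 ?sqr_ge0.
  by rewrite ler_wpM2l// normal_pdf_quad_bound.
- by apply: integrableZl => //; exact: integrable_normal_pdf.
Qed.

(** The half of the exponent that remains after [normal_pdf_quad_bound] is at most a constant over
    [1 + u], and [n + 1 <= 2 (1 + |a|) (1 + u)], which gives decay like [1 / (n + 1)]. The sign [s]
    covers both ends of the line. *)
Lemma normal_pdf_quad_cvg0 a v (s : R) : 0 < v -> `|s| = 1 ->
  N a v (s * n.+1%:R) * (1 + (s * n.+1%:R - a) ^+ 2) @[n --> \oo] --> 0.
Proof.
move=> v0 s1.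
pose K := (1 + 4 * v) * normal_peak (Num.sqrt v) * (1 + 4 * v) * 2 * (1 + `|a|).
have K0 : (1 + 4 * v) * normal_peak (Num.sqrt v) >= 0.
  by rewrite mulr_ge0 ?normal_peak_ge0// addr_ge0// mulr_ge0// ltW.
apply: (@squeeze_cvgr _ _ _ _ (cst 0) (fun n => K * harmonic n)).
- apply: nearW => n; set t := s * _; apply/andP; split.
    by rewrite mulr_ge0 ?normal_pdf_ge0// addr_ge0 ?sqr_ge0.
  apply: (le_trans (normal_pdf_quad_bound a t v0)).
  have -> : K * harmonic n = (1 + 4 * v) * normal_peak (Num.sqrt v) *
      ((1 + 4 * v) * 2 * (1 + `|a|) * harmonic n) by rewrite /K; ring.
  rewrite ler_wpM2l//.
  set u := (t - a) ^+ 2.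
  have u0 : 0 <= u by exact: sqr_ge0.
  rewrite expRN -[leLHS]mul1r ler_pdivrMr ?expR_gt0//.
  have tn : `|t| = n.+1%:R by rewrite normrM s1 mul1r normr_nat.
  have E := quad_le_expR v0 u0.
  have n0 : (0 : R) < n.+1%:R by [].
  have nu : n.+1%:R <= 2 * (1 + `|a|) * (1 + u).
    have : n.+1%:R <= `|t - a| + `|a|.
      by rewrite -tn (le_trans _ (ler_normD _ _))// subrK.
    have -> : u = `|t - a| ^+ 2 by rewrite real_normK ?num_real.
    have := normr_ge0 (t - a); have := normr_ge0 a.
    move: `|t - a| `|a| => w b b0 w0 h; apply: (le_trans h).
    have := sqr_ge0 (w - 1); have := mulr_ge0 b0 (sqr_ge0 w); nra.
  rewrite /harmonic.
  have -> : (1 + 4 * v) * 2 * (1 + `|a|) * n.+1%:R^-1 * expR (u / (4 * v)) =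
    (2 * (1 + `|a|) * ((1 + 4 * v) * expR (u / (4 * v)))) / n.+1%:R.
    by field; rewrite addrC natr1 gt_eqF.
  by rewrite ler_pdivlMr// mul1r (le_trans nu)// ler_wpM2l.
- exact: cvg_cst.
- rewrite -[0](mulr0 K); apply: cvgM; [exact: cvg_cst|exact: cvg_harmonic].
Qed.

(** The form of integration by parts used for both the second moment of the normal law and Stein's
    identity: one weight, a Gaussian times [1 + (t - a)^2], controls the boundary terms and the
    integrability. *)
Lemma integral_derive_normal_dominated_eq0 a v C F f : 0 < v ->
  (forall t, is_derive t 1 F (f t)) -> continuous f ->
  (forall t, `|F t| <= C * (N a v t * (1 + (t - a) ^+ 2))) ->
  (forall t, `|f t| <= C * (N a v t * (1 + (t - a) ^+ 2))) ->
  (\int[mu]_t (f t)%:E = 0)%E.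
Proof.
move=> v0 dF cf FC fC.
have F0 s : `|s| = 1 -> F (s * n.+1%:R) @[n --> \oo] --> 0.
  move=> s1; apply/norm_cvg0P.
  apply: (@squeeze_cvgr _ _ _ _ (cst 0) (fun n => C * (N a v (s * n.+1%:R) *
    (1 + (s * n.+1%:R - a) ^+ 2)))).
  - by apply: nearW => n; rewrite normr_ge0/= FC.
  - exact: cvg_cst.
  - rewrite -[0](mulr0 C); apply: cvgM; first exact: cvg_cst.
    exact: normal_pdf_quad_cvg0.
apply: (integral_derive_eq0 dF) => //.
- by apply: (integrable_normal_pdf_quad (C := C) v0) fC => //; exact: continuous_measurable_fun.
- by have := F0 1 (normr1 _); under eq_fun do rewrite mul1r.
- by have := F0 (- 1) (normrN1 _); under eq_fun do rewrite mulN1r.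
Qed.

(** Since [(t - d)^2 - (a - d)^2 = (t - a) (t + a - 2 d)] and the density has logarithmic derivative
    [- (t - a) / v], the function [(t + a - 2 d) N] has derivative
    [N + ((a - d)^2 - (t - d)^2) / v N]. Its integral is zero, which determines the second
    moment. *)
Lemma integral_normal_pdf_sqr a v d : 0 < v ->
  (\int[mu]_t (N a v t * (t - d) ^+ 2)%:E = (v + (a - d) ^+ 2)%:E)%E.
Proof.
move=> v0.
have vn : v != 0 by rewrite gt_eqF.
have cN : continuous (N a v).
  by apply: continuous_normal_pdf; rewrite gt_eqF ?sqrtr_gt0.
have N0 t : 0 <= N a v t by exact: normal_pdf_ge0.
pose q t := N a v t * (t - d) ^+ 2.
have cq : continuous q.
  move=> t; apply: cvgM; first exact: cN.
  by apply: (is_derive_continuous (f := fun t => (t - d) ^+ 2) (df := 2 * (t - d)));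
    apply: is_derive_eq; rewrite /GRing.scale/=; ring.
have iN : mu.-integrable setT (EFin \o N a v) by exact: integrable_normal_pdf.
have iq : mu.-integrable setT (EFin \o q).
  apply: (@integrable_normal_pdf_quad a v _ (2 + 2 * (a - d) ^+ 2)) => //.
    exact: continuous_measurable_fun.
  move=> t; rewrite /q normrM (ger0_norm (N0 t)) (ger0_norm (sqr_ge0 _)).
  rewrite [leRHS]mulrCA ler_wpM2l//.
  have -> : t - d = (t - a) + (a - d) by ring.
  by move: (t - a) (a - d) => x y; nra.
pose F t := (t + (a - 2 * d)) * N a v t.
pose f t := N a v t + ((a - d) ^+ 2 / v * N a v t - v^-1 * q t).
have dF t : is_derive t 1 F (f t).
  have := is_derive_normal_pdf a t v0 => ?.
  apply: is_derive_eq; rewrite /GRing.scale /= /f /q.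
  by field.
have E : (\int[mu]_t (f t)%:E = 0)%E.
  (* A sum of two crude constants: [2 + 2 |a - d|] bounds [F], and the remaining terms help to bound
     [f] through [(t - d)^2 <= (2 + 2 (a - d)^2) (1 + (t - a)^2)]. *)
  apply: (@integral_derive_normal_dominated_eq0 a v
    (2 + `|a - d| *+ 2 + (1 + (a - d) ^+ 2 / v + v^-1 * (2 + 2 * (a - d) ^+ 2))) F) => //.
  - move=> t; apply: cvgD; first exact: cN.
    by apply: cvgB; (apply: cvgM; [exact: cvg_cst|]); [exact: cN|exact: cq].
  - move=> t; rewrite /F normrM (ger0_norm (N0 t)) mulrC mulrCA ler_wpM2l//.
    have -> : t + (a - 2 * d) = (t - a) + (a - d) *+ 2 by ring.
    apply: (le_trans (ler_normD _ _)); rewrite normrMn.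
    rewrite -[in leRHS](real_normK (num_real (t - a))).
    have : 0 <= (a - d) ^+ 2 / v by rewrite divr_ge0 ?sqr_ge0 ?ltW.
    have : 0 <= v^-1 * (2 + 2 * (a - d) ^+ 2).
      by apply: mulr_ge0; [rewrite invr_ge0 ltW|rewrite addr_ge0// mulr_ge0// sqr_ge0].
    have := normr_ge0 (t - a); have := normr_ge0 (a - d).
    move: (_ / v) (v^-1 * _) `|t - a| `|a - d| => x y z w w0 z0 y0 x0.
    have := sqr_ge0 (z - 1); have := mulr_ge0 w0 (sqr_ge0 z).
    have := mulr_ge0 x0 (sqr_ge0 z); have := mulr_ge0 y0 (sqr_ge0 z); nra.
  - move=> t.
    have -> : f t = N a v t * (1 + (a - d) ^+ 2 / v - v^-1 * (t - d) ^+ 2).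
      by rewrite /f /q; ring.
    rewrite normrM (ger0_norm (N0 t)) [leRHS]mulrCA ler_wpM2l//.
    apply: (le_trans (ler_normB _ _)).
    rewrite ger0_norm; last by rewrite addr_ge0// divr_ge0 ?sqr_ge0 ?ltW.
    rewrite ger0_norm; last by rewrite mulr_ge0 ?sqr_ge0 ?invr_ge0 ?ltW.
    have x0 : 0 <= (a - d) ^+ 2 / v by rewrite divr_ge0 ?sqr_ge0 ?ltW.
    have h : v^-1 * (t - d) ^+ 2 <=
        v^-1 * (2 + 2 * (a - d) ^+ 2) * (1 + (t - a) ^+ 2).
      rewrite -mulrA ler_pM2l ?invr_gt0//.
      have -> : t - d = (t - a) + (a - d) by ring.
      by move: (t - a) (a - d) => x y; nra.
    apply: (le_trans (lerD (lexx _) h)).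
    move: x0 (normr_ge0 (a - d)) (sqr_ge0 (t - a)).
    move: (_ / v) (v^-1 * (2 + _)) ((t - a) ^+ 2) `|_| => x y w b x0 b0 w0.
    have := mulr_ge0 x0 w0; have := mulr_ge0 b0 w0; nra.
have : (\int[mu]_t (f t)%:E = 1 + (((a - d) ^+ 2 / v)%:E - (v^-1)%:E * \int[mu]_t (q t)%:E))%E.
  have i1 : mu.-integrable setT (fun t => (((a - d) ^+ 2 / v)%:E * (N a v t)%:E)%E).
    exact: integrableZl.
  have i2 : mu.-integrable setT (fun t => ((v^-1)%:E * (q t)%:E)%E).
    exact: integrableZl.
  transitivity (\int[mu]_t ((N a v t)%:E + ((((a - d) ^+ 2 / v)%:E * (N a v t)%:E) -
     ((v^-1)%:E * (q t)%:E))))%E.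
    by apply: eq_integral => t _; rewrite -!EFinM -EFinB -EFinD.
  apply: etrans (integralD measurableT iN (integrableB measurableT i1 i2)) _.
  rewrite /= integral_normal_pdf (integralB measurableT i1 i2) !integralZl//.
  by rewrite integral_normal_pdf mule1.
rewrite E.
have /fineK <- : (\int[mu]_t (q t)%:E)%E \is a fin_num by exact: integrable_fin_num.
rewrite -EFinM -EFinB -EFinD => -[].
move: (fine _) => z h; congr EFin.
apply: (mulfI (x := v^-1)); first by rewrite invr_eq0.
have -> : v^-1 * z = 1 + (a - d) ^+ 2 / v by lra.
by field.
Qed.

End gaussian_line.

(** * Gaussian integrals on row vectors and the lower bound on the risk *)

Section gaussian_rV.
Context {R : realType}.
Notation mu := (@lebesgue_measure R).
Notation N a v := (normal_pdf a (Num.sqrt v)).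

(** The inverse is [t] times the power [-1] of [t^2], a nonnegative base to which measurability of
    real powers applies; at zero both expressions are zero. *)
Lemma measurable_funV d (T : measurableType d) (f : T -> R) :
  measurable_fun setT f -> measurable_fun setT (fun t => (f t)^-1).
Proof.
move=> mf.
have -> : (fun t => (f t)^-1) = fun t => f t * (f t ^+ 2) `^ (-1).
  apply/funext => t; rewrite powR_inv1 ?sqr_ge0//.
  have [->|ft0] := eqVneq (f t) 0; first by rewrite invr0 mul0r.
  by rewrite expr2 invfM mulrA divff// mul1r.
apply: measurable_funM => //.
by apply: (measurableT_comp (measurable_powR (-1))); exact: measurable_funX.
Qed.

Context {k : nat}.
Implicit Types (x theta d : 'rV[R]_k) (v : R).

Lemma sqnorm_ge0 x : 0 <= sqnorm x.
Proof. by apply: sumr_ge0 => i _; exact: sqr_ge0. Qed.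

Lemma sqnormBC x d : sqnorm (x - d) = sqnorm (d - x).
Proof. by rewrite -opprB /sqnorm; apply: eq_bigr => i _; rewrite mxE sqrrN. Qed.

Lemma measurable_sqnormB disp (T : measurableType disp) (f g : T -> 'rV[R]_k) :
  measurable_fun setT f -> measurable_fun setT g ->
  measurable_fun setT (fun t => sqnorm (f t - g t)).
Proof.
move=> mf mg; rewrite /sqnorm; apply: measurable_sum => i.
apply: measurable_funX.
under eq_fun do rewrite !mxE.
by apply: measurable_funB; apply: (measurableT_comp (measurable_coord i)).
Qed.

Lemma measurable_sqnorm : measurable_fun setT (@sqnorm R k).
Proof.
have := @measurable_sqnormB _ _ (@id 'rV[R]_k) (cst 0) (@measurable_id _ _ _)
  (measurable_cst _).
by under eq_fun do rewrite /= subr0.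
Qed.

(** Mean, variance and point all vary, because Tonelli's theorem is applied to pairs of them. *)
Lemma measurable_normal_density disp (T : measurableType disp)
    (theta x : T -> 'rV[R]_k) (v : T -> R) :
  measurable_fun setT theta -> measurable_fun setT v -> measurable_fun setT x ->
  measurable_fun setT (fun t => normal_density (theta t) (v t) (x t)).
Proof.
move=> mtheta mv mx; apply: measurable_funM.
  apply: (measurableT_comp (measurable_powR _)).
  exact: measurable_funM.
apply: (measurableT_comp (@measurable_expR R)).
apply: measurable_funN; apply: measurable_funM.
  exact: measurable_sqnormB.
by apply: measurable_funV; exact: measurable_funM.
Qed.

Lemma normal_density_ge0 theta v x : 0 <= normal_density theta v x.
Proof. by rewrite mulr_ge0 ?powR_ge0 ?expR_ge0. Qed.

Lemma normal_densityE theta v x : 0 < v ->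
  normal_density theta v x = \prod_(i < k) N (theta 0 i) v (x 0 i).
Proof.
move=> v0; under eq_bigr do rewrite normal_pdf_sqrtE//.
rewrite big_split/= prodr_const card_ord -expR_sum; congr (_ * expR _).
  rewrite powRN (mulrC k%:R) powRrM powR12_sqrt ?powR_mulrn ?sqrtr_ge0//; last first.
    by rewrite !mulr_ge0 ?pi_ge0 ?ltW.
  rewrite /normal_peak exprVn sqr_sqrtr ?ltW// -mulr_natl.
  by congr (Num.sqrt _ ^+ _)^-1; ring.
rewrite sumrN; congr (- _); rewrite mulr_suml; apply: eq_bigr => i _.
by rewrite !mxE.
Qed.

Lemma integral_normal_density theta v : 0 < v ->
  (\int[lebesgue_rV k]_x (normal_density theta v x)%:E = 1)%E.
Proof.
move=> v0; under eq_integral do rewrite normal_densityE//.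
rewrite (integral_rV_prod (f := fun i => N (theta 0 i) v)).
- by rewrite big1// => i _; exact: integral_normal_pdf.
- by move=> i; exact: measurable_normal_pdf.
- by move=> i t; exact: normal_pdf_ge0.
Qed.

Lemma integral_normal_density_coord theta v (i : 'I_k) (q : R -> R) : 0 < v ->
  measurable_fun setT q -> (forall t, 0 <= q t) ->
  (\int[lebesgue_rV k]_x (normal_density theta v x * q (x 0 i))%:E =
   \int[mu]_t (N (theta 0 i) v t * q t)%:E)%E.
Proof.
move=> v0 mq q0.
pose f (j : 'I_k) t := N (theta 0 j) v t * if j == i then q t else 1.
have -> : (fun x => (normal_density theta v x * q (x 0 i))%:E) =
    (fun x => (\prod_(j < k) f j (x 0 j))%:E).
  apply/funext => x; rewrite normal_densityE// /f big_split/=.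
  by rewrite -big_mkcond/= big_pred1_eq.
rewrite integral_rV_prod.
- rewrite (bigD1 i)//= {1}/f eqxx big1 ?mule1// => j ji.
  rewrite /f (negbTE ji); under eq_integral do rewrite mulr1.
  exact: integral_normal_pdf.
- move=> j; apply: measurable_funM; first exact: measurable_normal_pdf.
  by case: (j == i).
- by move=> j t; rewrite /f mulr_ge0 ?normal_pdf_ge0//; case: ifP.
Qed.

(** With [d = theta] and [v = 1] this is the risk [k] of the usual estimator; with a posterior mean
    and variance it is the posterior risk of the estimate [d]. *)
Lemma integral_normal_density_sqnorm theta v d : 0 < v ->
  (\int[lebesgue_rV k]_x (normal_density theta v x * sqnorm (x - d))%:E =
   (k%:R * v + sqnorm (theta - d))%:E)%E.
Proof.
move=> v0.
have E x : (normal_density theta v x * sqnorm (x - d))%:E =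
   (\sum_(i < k) (normal_density theta v x * (x 0 i - d 0 i) ^+ 2)%:E)%E.
  rewrite sumEFin /sqnorm mulr_sumr; congr EFin.
  by apply: eq_bigr => i _; rewrite !mxE.
under eq_integral do rewrite E.
have mq (i : 'I_k) : measurable_fun setT (fun t : R => (t - d 0 i) ^+ 2).
  by apply: measurable_funX; exact: measurable_funB.
rewrite ge0_integral_sum//.
- under eq_bigr => i _.
    rewrite (@integral_normal_density_coord _ _ i (fun t => (t - d 0 i) ^+ 2))//;
      last by move=> t; exact: sqr_ge0.
    rewrite integral_normal_pdf_sqr//.
    over.
  rewrite sumEFin big_split/= sumr_const card_ord mulr_natl /sqnorm.
  by under [in RHS]eq_bigr do rewrite !mxE.
- move=> i; apply/measurable_EFinP; apply: measurable_funM.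
    exact: measurable_normal_density.
  by apply: (measurableT_comp (mq i)); exact: measurable_coord.
- by move=> i x _; rewrite lee_fin mulr_ge0 ?normal_density_ge0 ?sqr_ge0.
Qed.

(* Bayes' formula for the conjugate prior [N(0, v)]. *)
Lemma normal_density_posterior theta v x : 0 < v ->
  normal_density theta 1 x * normal_density 0 v theta =
  normal_density 0 (1 + v) x *
  normal_density ((v / (1 + v)) *: x) (v / (1 + v)) theta.
Proof.
move=> v0; have v1 : 0 < 1 + v by rewrite addr_gt0.
have p2 : 0 < 2 * pi :> R by rewrite mulr_gt0 ?pi_gt0.
have p2ge (w : R) : 0 <= w -> 0 <= 2 * pi * w by move=> w0; rewrite mulr_ge0// ltW.
have [v_ge0 v1_ge0] : 0 <= v /\ 0 <= 1 + v by split; exact: ltW.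
have c_ge0 : 0 <= v / (1 + v) by rewrite divr_ge0.
rewrite /normal_density mulrACA -powRM ?p2ge// -expRD.
rewrite [RHS]mulrACA -expRD -powRM ?p2ge//.
congr (_ `^ _ * expR _).
  by field; rewrite gt_eqF.
rewrite !subr0 -!opprD; congr (- _).
rewrite /sqnorm !mulr_suml -!big_split/=; apply: eq_bigr => i _; rewrite !mxE.
by field; rewrite !gt_eqF.
Qed.

Lemma risk_ge0 (delta : 'rV[R]_k -> 'rV[R]_k) theta : (0 <= risk delta theta)%E.
Proof.
apply: integral_ge0 => x _; rewrite lee_fin mulr_ge0 ?normal_density_ge0//.
by apply: sumr_ge0 => i _; exact: sqr_ge0.
Qed.

(* The maximal risk dominates the Bayes risk under the prior [N(0, v)], whose
   infimum is [k v / (1 + v)]. *)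
Lemma max_risk_ge_bayes (delta : 'rV[R]_k -> 'rV[R]_k) v :
  measurable_fun setT delta -> 0 < v ->
  ((k%:R * (v / (1 + v)))%:E <= max_risk delta)%E.
Proof.
move=> mdelta v0.
have v1 : 0 < 1 + v by rewrite addr_gt0.
have c0 : 0 < v / (1 + v) by rewrite divr_gt0.
pose F (z : 'rV[R]_k * 'rV[R]_k) : \bar R :=
  (normal_density 0 v z.1 * (normal_density z.1 1 z.2 * sqnorm (delta z.2 - z.1)))%:E.
have mF : measurable_fun setT F.
  apply/measurable_EFinP; apply: measurable_funM.
    by apply: measurable_normal_density => //; exact: measurable_fst.
  apply: measurable_funM.
    exact: measurable_normal_density.
  apply: measurable_sqnormB; last exact: measurable_fst.
  by apply: measurableT_comp => //; exact: measurable_snd.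
have F0 z : (0 <= F z)%E.
  rewrite /F lee_fin; apply: mulr_ge0; first exact: normal_density_ge0.
  by apply: mulr_ge0; [exact: normal_density_ge0|exact: sqnorm_ge0].
have mnd w : measurable_fun setT (fun t : 'rV[R]_k => (normal_density 0 w t)%:E).
  by apply/measurable_EFinP; exact: measurable_normal_density.
apply: (@le_trans _ _ (\int[lebesgue_rV k]_theta \int[lebesgue_rV k]_x F (theta, x)))%E.
  (* With [x] outermost, the inner integral is the marginal density times the posterior risk: the
     posterior variance [v / (1 + v)] in each coordinate plus a squared bias, which is then
     dropped. *)
  rewrite fubini_tonelli//.
  have -> : (fun x => \int[lebesgue_rV k]_theta F (theta, x))%E =
     (fun x => (normal_density 0 (1 + v) x)%:E *
       (k%:R * (v / (1 + v)) + sqnorm ((v / (1 + v)) *: x - delta x))%:E)%E.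
    apply/funext => x; rewrite -integral_normal_density_sqnorm//.
    rewrite -ge0_integralZl//.
    - apply: eq_integral => theta _; rewrite /F/= -EFinM; congr EFin.
      rewrite (sqnormBC theta) [LHS]mulrA [RHS]mulrA; congr (_ * _).
      by rewrite mulrC normal_density_posterior.
    - apply/measurable_EFinP; apply: measurable_funM; first exact: measurable_normal_density.
      exact: measurable_sqnormB.
    - by move=> y _; rewrite lee_fin mulr_ge0 ?normal_density_ge0 ?sqnorm_ge0.
    - by rewrite lee_fin normal_density_ge0.
  apply: (@le_trans _ _ (\int[lebesgue_rV k]_x
      ((normal_density 0 (1 + v) x)%:E * (k%:R * (v / (1 + v)))%:E)))%E.
    rewrite ge0_integralZr//.
    - by rewrite integral_normal_density// mul1e.
    - by move=> x _; rewrite lee_fin normal_density_ge0.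
    - by rewrite lee_fin mulr_ge0// ltW.
  apply: ge0_le_integral => //.
  - move=> x _; apply: mule_ge0; rewrite lee_fin ?normal_density_ge0//.
    by rewrite mulr_ge0// ltW.
  - exact: emeasurable_funM.
  - apply: emeasurable_funM => //; apply/measurable_EFinP; apply: measurable_funD => //.
    apply: measurable_sqnormB => //; apply: measurable_rVP => i.
    under eq_fun do rewrite mxE.
    by apply: measurable_funM => //; exact: measurable_coord.
  - by move=> x _; rewrite -!EFinM lee_fin ler_wpM2l ?normal_density_ge0// lerDl sqnorm_ge0.
(* The prior has total mass one, so the maximal risk equals its own average, and the comparison
   takes place under the integral. *)
have -> : max_risk delta =
    (\int[lebesgue_rV k]_theta ((normal_density 0 v theta)%:E * max_risk delta))%E.
  rewrite ge0_integralZr//.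
  - by rewrite integral_normal_density// mul1e.
  - by move=> x _; rewrite lee_fin normal_density_ge0.
  - apply: le_trans (risk_ge0 delta 0) _.
    by apply: ereal_sup_ubound; exists 0.
apply: ge0_le_integral => //.
- by move=> theta _; exact: integral_ge0.
- exact: measurable_fun_fubini_tonelli_F.
- exact: emeasurable_funM.
move=> theta _.
have -> : (\int[lebesgue_rV k]_x F (theta, x))%E =
   ((normal_density 0 v theta)%:E * risk delta theta)%E.
  rewrite /risk -ge0_integralZl//.
  - apply/measurable_EFinP; apply: measurable_funM; first exact: measurable_normal_density.
    by apply: measurable_sqnormB.
  - by move=> y _; rewrite lee_fin mulr_ge0 ?normal_density_ge0 ?sqnorm_ge0.
  - by rewrite lee_fin normal_density_ge0.
apply: lee_wpmul2l; first by rewrite lee_fin normal_density_ge0.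
by apply: ereal_sup_ubound; exists theta.
Qed.

Lemma max_risk_ge (delta : 'rV[R]_k -> 'rV[R]_k) :
  measurable_fun setT delta -> (k%:R%:E <= max_risk delta)%E.
Proof.
move=> mdelta; apply/lee_addgt0Pr => e e0.
(* The Bayes bound falls short of [k] by [k / (1 + v)], which is at most [e] for [v = k / e + 1]. *)
have v0 : 0 < k%:R / e + 1 by rewrite ltr_pwDr// divr_ge0// ltW.
have := max_risk_ge_bayes mdelta v0.
set v := _ / e + 1 in v0 *.
have v1 : 0 < 1 + v by exact: addr_gt0.
move=> /(leeD2r e%:E); apply: le_trans.
rewrite -EFinD lee_fin.
have -> : v / (1 + v) = 1 - (1 + v)^-1 by field; rewrite gt_eqF.
rewrite mulrBr mulr1 -addrA lerDl addrC subr_ge0 ler_pdivrMr//.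
rewrite /v mulrDr mulr1 mulrDr mulr1 mulrCA divff ?gt_eqF// mulr1.
by rewrite addrCA lerDl addr_ge0 ?(ltW e0).
Qed.

(** As every maximal risk is at least [k], a pointwise bound by [k] on the risk already places
    [delta] at the infimum. *)
Lemma minimax_of_risk_le (delta : 'rV[R]_k -> 'rV[R]_k) :
  measurable_fun setT delta -> (forall theta, (risk delta theta <= k%:R%:E)%E) ->
  minimax delta.
Proof.
move=> mdelta rk; split=> //; apply/le_anti/andP; split.
  apply: le_ereal_inf_tmp => _ [d md <-]; apply: le_trans (max_risk_ge md).
  by apply: ge_ereal_sup => _ [theta _ <-].
by apply: ereal_inf_lbound; exists delta.
Qed.

End gaussian_rV.

(** * Stein's identity for shrinkage estimators *)

Section shrinkage.
Context {R : realType} {k : nat}.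
Notation mu := (@lebesgue_measure R).
Notation N a v := (normal_pdf a (Num.sqrt v)).
(** The bounds are asked on [s >= 0], the range of [|x|^2 / 2]. Differentiability is two-sided at
    [0] as well, so that the chain rule applies at the origin. *)
Variables psi dpsi : R -> R.
Hypothesis dpsiE : forall s : R, is_derive s 1 psi (dpsi s).
Hypothesis dpsi_cont : continuous dpsi.
Hypothesis psi_le1 : forall s, 0 <= s -> `|psi s| <= 1.
Hypothesis dpsi_le1 : forall s, 0 <= s -> `|dpsi s| <= 1.
Implicit Types (x theta : 'rV[R]_k).

Let psi_cont : continuous psi.
Proof. by move=> s; exact: is_derive_continuous (dpsiE s). Qed.

Let s_ x := sqnorm x / 2.

Let s_ge0 x : 0 <= s_ x. Proof. by rewrite divr_ge0// sqnorm_ge0. Qed.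

Let measurable_comp_s (f : R -> R) : continuous f ->
  measurable_fun setT (fun x => f (s_ x)).
Proof.
move=> cf; apply: measurableT_comp; first exact: continuous_measurable_fun.
by apply: measurable_funM => //; exact: measurable_sqnorm.
Qed.

(* The [i]-th partial derivative of [p x * x 0 i * psi (|x|^2 / 2)], where [p] is
   the density of [N(theta, I)]. *)
Definition stein_term theta (i : 'I_k) x : R :=
  normal_density theta 1 x *
  (psi (s_ x) + x 0 i ^+ 2 * dpsi (s_ x) - (x 0 i - theta 0 i) * (x 0 i * psi (s_ x))).

Lemma measurable_stein_term theta i : measurable_fun setT (stein_term theta i).
Proof.
have mi := @measurable_coord R k i.
apply: measurable_funM; first exact: measurable_normal_density.
apply: measurable_funB.
  apply: measurable_funD; first exact: measurable_comp_s.
  by apply: measurable_funM; [exact: measurable_funX|exact: measurable_comp_s].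
apply: measurable_funM; first exact: measurable_funB.
by apply: measurable_funM => //; exact: measurable_comp_s.
Qed.

(** The bracket grows at most quadratically, and [|t| <= |t - a| + |a|] recentres it at [a]. The
    constant depends on [a] alone, hence the bound is uniform in the other coordinates. *)
Lemma stein_bracket_le (t a p q : R) : `|p| <= 1 -> `|q| <= 1 ->
  `|p + t ^+ 2 * q - (t - a) * (t * p)| <= (4 + 3 * a ^+ 2) * (1 + (t - a) ^+ 2).
Proof.
move=> p1 q1; apply: (@le_trans _ _ (1 + t ^+ 2 + `|t - a| * `|t|)).
  apply: (le_trans (ler_normB _ _)); apply: lerD.
    apply: (le_trans (ler_normD _ _)); apply: lerD => //.
    by rewrite normrM ger0_norm ?sqr_ge0// ler_piMr ?sqr_ge0.
  by rewrite !normrM ler_wpM2l// ler_piMr.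
have -> : t ^+ 2 = `|t| ^+ 2 by rewrite real_normK ?num_real.
have -> : (t - a) ^+ 2 = `|t - a| ^+ 2 by rewrite real_normK ?num_real.
have -> : a ^+ 2 = `|a| ^+ 2 by rewrite real_normK ?num_real.
have : `|t| <= `|t - a| + `|a| by rewrite (le_trans _ (ler_normD _ _))// subrK.
move: (normr_ge0 t) (normr_ge0 (t - a)) (normr_ge0 a).
move: `|t| `|t - a| `|a| => u w b u0 w0 b0 ub.
have h1 : u ^+ 2 <= (w + b) ^+ 2 by rewrite ler_sqr ?nnegrE ?addr_ge0.
have h2 : w * u <= w * (w + b) by rewrite ler_wpM2l.
have := sqr_ge0 (w - b); have := mulr_ge0 (sqr_ge0 b) (sqr_ge0 w).
by nra.
Qed.

Lemma stein_term_le theta i x :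
  `|stein_term theta i x| <= normal_density theta 1 x *
    ((4 + 3 * theta 0 i ^+ 2) * (1 + (x 0 i - theta 0 i) ^+ 2)).
Proof.
rewrite normrM ger0_norm ?normal_density_ge0// ler_wpM2l ?normal_density_ge0//.
by apply: stein_bracket_le; [exact: psi_le1|exact: dpsi_le1].
Qed.

(** The dominating function is the Gaussian density times a function of the [i]-th coordinate, so
    its integral reduces to one on the line. *)
Lemma integrable_stein_term theta i :
  (lebesgue_rV k).-integrable setT (EFin \o stein_term theta i).
Proof.
pose q t := (4 + 3 * theta 0 i ^+ 2) * (1 + (t - theta 0 i) ^+ 2).
have q0 t : 0 <= q t.
  by rewrite mulr_ge0// addr_ge0// ?sqr_ge0// mulr_ge0// sqr_ge0.
have mq : measurable_fun setT q.
  by apply: measurable_funM => //; apply: measurable_funD => //; apply: measurable_funX; exact: measurable_funB.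
have mst := measurable_stein_term theta i.
apply/integrableP; split; first exact/measurable_EFinP.
apply: (@le_lt_trans _ _
    (\int[lebesgue_rV k]_x (normal_density theta 1 x * q (x 0 i))%:E)%E).
  apply: ge0_le_integral => //.
  - by apply/measurable_EFinP; exact: measurableT_comp.
  - apply/measurable_EFinP; apply: measurable_funM; first exact: measurable_normal_density.
    by apply: (measurableT_comp mq); exact: measurable_coord.
  - by move=> x _; rewrite lee_fin; exact: stein_term_le.
rewrite integral_normal_density_coord//.
have : mu.-integrable setT (EFin \o (fun t => N (theta 0 i) 1 t * q t)).
  apply: (@integrable_normal_pdf_quad _ (theta 0 i) 1 _ (4 + 3 * theta 0 i ^+ 2)) => //.
    by apply: measurable_funM => //; exact: measurable_normal_pdf.
  move=> t; rewrite ger0_norm; last exact: mulr_ge0 (normal_pdf_ge0 _ _ _) (q0 t).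
  by rewrite /q mulrCA.
by move=> /integrable_lty; apply.
Qed.

Lemma stein_term_set_coord theta i x t :
  stein_term theta i (set_coord i t x) =
  \prod_(j < k | j != i) N (theta 0 j) 1 (x 0 j) *
  (N (theta 0 i) 1 t *
   (let s := (t ^+ 2 + \sum_(j < k | j != i) x 0 j ^+ 2) / 2 in
    psi s + t ^+ 2 * dpsi s - (t - theta 0 i) * (t * psi s))).
Proof.
rewrite /stein_term normal_densityE// (bigD1 i)//= mulrAC mulrA mulrC -mulrA.
have Ei : set_coord i t x 0 i = t by rewrite mxE eqxx.
have Es : s_ (set_coord i t x) = (t ^+ 2 + \sum_(j < k | j != i) x 0 j ^+ 2) / 2.
  rewrite /s_ /sqnorm (bigD1 i)//= Ei; congr ((_ + _) / _).
  by apply: eq_bigr => j ji; rewrite mxE (negbTE ji).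
rewrite Es Ei; congr (_ * _).
by apply: eq_bigr => j ji; rewrite mxE (negbTE ji).
Qed.

Lemma integral_stein_term_line theta i x :
  (\int[mu]_t (stein_term theta i (set_coord i t x))%:E = 0)%E.
Proof.
under eq_integral do rewrite stein_term_set_coord.
set P := \prod_(j < k | _) _; set c := \sum_(j < k | _) _; set a := theta 0 i.
have P0 : 0 <= P by apply: prodr_ge0 => j _; exact: normal_pdf_ge0.
have c0 : 0 <= c by apply: sumr_ge0 => j _; exact: sqr_ge0.
have c20 t : 0 <= (t ^+ 2 + c) / 2 by rewrite divr_ge0// addr_ge0// sqr_ge0.
have N0 t : 0 <= N a 1 t by exact: normal_pdf_ge0.
pose S t := (t ^+ 2 + c) / 2.
have dS (t : R) : is_derive t 1 S t.
  by apply: is_derive_eq; rewrite /GRing.scale/=; field.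
have cS t : {for t, continuous S} by exact: is_derive_continuous (dS t).
pose F t := P * (N a 1 t * (t * psi (S t))).
pose f t := P * (N a 1 t *
  (psi (S t) + t ^+ 2 * dpsi (S t) - (t - a) * (t * psi (S t)))).
have dN (t : R) : is_derive t 1 (N a 1) (- (t - a) / 1 * N a 1 t).
  exact: is_derive_normal_pdf.
have dpS (t : R) : is_derive t 1 (psi \o S) (dpsi (S t) * t).
  by apply: is_derive1_comp.
rewrite -/(f _).
apply: (@integral_derive_normal_dominated_eq0 _ a 1 (P * (4 + 3 * a ^+ 2)) F f) => //.
- move=> t; rewrite /F.
  have -> : (fun t => P * (N a 1 t * (t * psi (S t)))) =
     (fun t => P * (N a 1 t * (t * (psi \o S) t))) by [].
  apply: is_derive_eq; rewrite /GRing.scale/= /f divr1.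
  by ring.
- have cid t : {for t, continuous (fun t : R => t)} by exact: cvg_id.
  have cN t : {for t, continuous (N a 1)} by exact: is_derive_continuous (dN t).
  have cpS t : {for t, continuous (psi \o S)} by exact: is_derive_continuous (dpS t).
  have cdS t : {for t, continuous (dpsi \o S)}.
    by apply: continuous_comp; [exact: cS|exact: dpsi_cont].
  move=> t; apply: cvgM; first exact: cvg_cst.
  apply: cvgM; first exact: cN.
  apply: cvgB; first apply: cvgD; first exact: cpS.
    apply: cvgM; last exact: cdS.
    by apply: (is_derive_continuous (f := fun t : R => t ^+ 2) (df := 2 * t));
      apply: is_derive_eq; rewrite /GRing.scale/=; ring.
  apply: cvgM; first by apply: cvgB; [exact: cvg_id|exact: cvg_cst].
  by apply: cvgM; [exact: cvg_id|exact: cpS].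
- move=> t; rewrite /F normrM (ger0_norm P0) -mulrA ler_wpM2l//.
  rewrite normrM (ger0_norm (N0 t)) mulrCA ler_wpM2l//.
  rewrite normrM; apply: (@le_trans _ _ `|t|); first by rewrite ler_piMr//; exact: psi_le1 (c20 t).
  have : `|t| <= `|t - a| + `|a| by rewrite (le_trans _ (ler_normD _ _))// subrK.
  have -> : (t - a) ^+ 2 = `|t - a| ^+ 2 by rewrite real_normK ?num_real.
  have -> : a ^+ 2 = `|a| ^+ 2 by rewrite real_normK ?num_real.
  move: (normr_ge0 t) (normr_ge0 (t - a)) (normr_ge0 a).
  move: `|t| `|t - a| `|a| => u w b u0 w0 b0 ub.
  have := sqr_ge0 (w - 1); have := sqr_ge0 (b - 1).
  have := mulr_ge0 (sqr_ge0 b) (sqr_ge0 w); nra.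
- move=> t; rewrite /f normrM (ger0_norm P0) -mulrA ler_wpM2l//.
  rewrite normrM (ger0_norm (N0 t)) [leRHS]mulrCA ler_wpM2l//.
  by apply: stein_bracket_le; [exact: psi_le1 (c20 t)|exact: dpsi_le1 (c20 t)].
Qed.

Lemma integral_stein_term theta i :
  (\int[lebesgue_rV k]_x (stein_term theta i x)%:E = 0)%E.
Proof.
apply: (integral_eq0_coord (i := i)); first exact: integrable_stein_term.
exact: integral_stein_term_line.
Qed.

(** With [|x|^2 = 2 s], the field [psi x] has divergence [k psi + 2 s psi'] and squared norm
    [2 s psi^2]. The left-hand side is twice the divergence plus the squared norm: Stein's unbiased
    estimate of the change in risk. *)
Hypothesis psi_ineq : forall s, 0 <= s ->
  2 * k%:R * psi s + 4 * s * dpsi s + 2 * s * psi s ^+ 2 <= 0.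

Let delta x := x + psi (s_ x) *: x.

(** The cross term [2 psi x . (x - theta)] of the expanded loss is carried by Stein terms, which
    integrate to zero; [psi_ineq] disposes of the rest. Because the inequality is pointwise with a
    nonnegative left-hand side, it passes to integrals by monotonicity. *)
Lemma shrinkage_loss_le theta x :
  normal_density theta 1 x * sqnorm (delta x - theta) <=
  normal_density theta 1 x * sqnorm (x - theta) +
  \sum_(i < k) (- 2) * stein_term theta i x.
Proof.
rewrite -mulr_sumr /stein_term -mulr_sumr mulrCA -mulrDr.
rewrite ler_wpM2l ?normal_density_ge0//.
rewrite -lerBlDl mulr_sumr /sqnorm -sumrB -subr_le0 -sumrB.
apply: le_trans (psi_ineq (s_ge0 x)).
rewrite le_eqVlt; apply/orP; left; apply/eqP.
set p := psi _; set q := dpsi _.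
transitivity (\sum_(i < k) (2 * p + (2 * q + p ^+ 2) * x 0 i ^+ 2)).
  by apply: eq_bigr => i _; rewrite /delta !mxE -/p; ring.
rewrite big_split/= sumr_const card_ord -mulr_sumr -/(sqnorm x).
have -> : sqnorm x = 2 * s_ x by rewrite /s_; field.
by rewrite -mulr_natl; ring.
Qed.

Lemma shrinkage_minimax : minimax delta.
Proof.
have mdelta : measurable_fun setT delta.
  apply: measurable_rVP => i; under eq_fun do rewrite !mxE.
  apply: measurable_funD; first exact: measurable_coord.
  by apply: measurable_funM; [exact: measurable_comp_s|exact: measurable_coord].
apply: minimax_of_risk_le => // theta.
have mnd : measurable_fun setT (normal_density theta 1).
  exact: measurable_normal_density.
have ilin : (lebesgue_rV k).-integrable setT
    (fun x => (normal_density theta 1 x * sqnorm (x - theta))%:E).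
  apply/integrableP; split.
    apply/measurable_EFinP; apply: measurable_funM => //.
    exact: measurable_sqnormB.
  have ge0 x : (0 <= (normal_density theta 1 x * sqnorm (x - theta))%:E)%E.
    by rewrite lee_fin; apply: mulr_ge0; [exact: normal_density_ge0|exact: sqnorm_ge0].
  under eq_integral do rewrite (gee0_abs (ge0 _)).
  by rewrite integral_normal_density_sqnorm// ltry.
have ist i : (lebesgue_rV k).-integrable setT
    (fun x => ((- 2)%:E * (stein_term theta i x)%:E)%E).
  by apply: integrableZl => //; exact: integrable_stein_term.
have isum : (lebesgue_rV k).-integrable setT
    (fun x => (\sum_(i < k) ((- 2)%:E * (stein_term theta i x)%:E))%E).
  exact: integrable_sum.
apply: (@le_trans _ _ (\int[lebesgue_rV k]_x
   ((normal_density theta 1 x * sqnorm (x - theta))%:E +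
    \sum_(i < k) ((- 2)%:E * (stein_term theta i x)%:E)))%E).
  have le x : ((normal_density theta 1 x * sqnorm (delta x - theta))%:E <=
    (normal_density theta 1 x * sqnorm (x - theta))%:E +
    \sum_(i < k) ((- 2)%:E * (stein_term theta i x)%:E))%E.
    under eq_bigr do rewrite -EFinM.
    by rewrite sumEFin -EFinD lee_fin shrinkage_loss_le.
  have ge0 x : (0 <= (normal_density theta 1 x * sqnorm (delta x - theta))%:E)%E.
    by rewrite lee_fin; apply: mulr_ge0; [exact: normal_density_ge0|exact: sqnorm_ge0].
  apply: ge0_le_integral => //.
  - apply/measurable_EFinP; apply: measurable_funM => //.
    exact: measurable_sqnormB.
  - apply: emeasurable_funD; first exact: measurable_int ilin.
    exact: measurable_int isum.
rewrite (integralD measurableT ilin isum) integral_normal_density_sqnorm//.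
rewrite integral_sum// big1 ?adde0; last first.
  by move=> i _; rewrite integralZl ?integral_stein_term ?mule0//; exact: integrable_stein_term.
by rewrite subrr /sqnorm big1 ?addr0 ?mulr1// => i _; rewrite mxE expr0n.
Qed.

End shrinkage.

(** * Change of variables *)

Section change_of_variables.
Context {R : realType}.
Notation mu := (@lebesgue_measure R).

(** Open left rays are stable under intersection and generate the Borel sets, so finite measures
    that agree on them coincide. *)
Lemma finite_measure_eq_rays (m1 m2 : {measure set (measurableTypeR R) -> \bar R}) :
  m1 setT = m2 setT -> (m1 setT < +oo)%E ->
  (forall x : R, m1 `]-oo, x[%classic = m2 `]-oo, x[%classic) ->
  forall A, measurable A -> m1 A = m2 A.
Proof.
move=> m12T m1oo m12 A mA.
have G_sub : @RGenInftyO.G R `<=` (@measurable _ (measurableTypeR R)).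
  by move=> _ [x ->]; exact: measurable_itv.
apply: (@g_sigma_algebra_measure_unique_trace _ _ (measurableTypeR R)
  (@RGenInftyO.G R) setT measurableT _ _ m1 m2 m12T _ m1oo) => //.
- by move=> X [/G_sub].
- move=> _ _ [[x ->] _] [[y ->] _]; split => //.
  exists (Num.min x y); apply/seteqP; split => z /=; rewrite !in_itv/= lt_min.
    by move=> [-> ->].
  by move=> /andP[].
- by move=> X [[x ->] _]; exact: m12.
- have -> : [set X | RGenInftyO.G X /\ X `<=` [set: measurableTypeR R]] = @RGenInftyO.G R.
    by apply/seteqP; split => [X []|X GX]//.
  by move: mA; rewrite RGenInftyO.measurableE.
Qed.

(* The undergraph of the density [w] under the product measure plays the role of
   the measure with density [w]. *)
Lemma ge0_integral_change_of_variables (D E : set R) (tau w : R -> R) (p : R) :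
  measurable D -> measurable E -> measurable_fun setT tau ->
  measurable_fun setT w -> (forall v, D v -> 0 <= w v) ->
  (forall v, D v -> E (tau v)) -> ~ E p ->
  (mu E < +oo)%E -> mu E = (\int[mu]_(v in D) (w v)%:E)%E ->
  (forall x : R, mu (E `&` [set t | (t < x)%R]) =
     \int[mu]_(v in D `&` [set v | (tau v < x)%R]) (w v)%:E)%E ->
  forall g : R -> \bar R, measurable_fun setT g -> (forall t, 0 <= g t)%E ->
  (\int[mu]_(t in E) g t = \int[mu]_(v in D) (g (tau v) * (w v)%:E))%E.
Proof.
move=> mD mE mtau mw w0 DE Ep Eoo muE muEx.
pose b (z : R * R) := [&& z.1 \in D, 0 < z.2 & z.2 < w z.1].
have mb : measurable_fun setT b.
  have m1 : measurable_fun setT (fun z : R * R => z.1 : R) by exact: measurable_fst.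
  have m2 : measurable_fun setT (fun z : R * R => z.2 : R) by exact: measurable_snd.
  apply: measurable_and.
    apply: (measurableT_comp (f := fun v : R => v \in D)) => //.
    apply: (measurable_fun_bool true); rewrite setTI.
    by rewrite (_ : _ @^-1` _ = D)//; apply/seteqP; split => v /=; [move=> /set_mem|move=> /mem_set].
  apply: measurable_and; first exact: measurable_fun_ltr.
  by apply: measurable_fun_ltr => //; exact: measurableT_comp.
(* Points off the undergraph are sent to [p], which is outside [E]: on [E] the pushforward only sees
   the undergraph, whose slice over [v] has length [w v]. *)
pose Phi (z : R * R) : measurableTypeR R := if b z then tau z.1 else p.
have mPhi : measurable_fun setT Phi.
  by apply: measurable_fun_ifT => //; apply: measurableT_comp => //; exact: measurable_fst.
pose nu : {measure set (measurableTypeR R) -> \bar R} :=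
  measure_function_pushforward__canonical__measure_function_Measure (mu \x mu)%E mPhi.
have nuE g : measurable_fun setT g -> (forall t, 0 <= g t)%E ->
  (\int[nu]_(t in E) g t = \int[mu]_(v in D) (g (tau v) * (w v)%:E))%E.
  move=> mg g0.
  rewrite /nu ge0_integral_pushforward//; last exact: measurable_funTS.
  rewrite integral_mkcond fubini_tonelli1; last 2 first.
  - apply/(measurable_restrictT _ _).1.
      by rewrite -[_ @^-1` _]setTI; exact: (mPhi measurableT _ mE).
    by apply: measurable_funTS; exact: measurableT_comp.
  - by move=> z; apply: erestrict_ge0 => y _; exact: g0.
  rewrite [RHS]integral_mkcond; apply: eq_integral => v _.
  rewrite /fubini_F patchE; case: ifPn => [/set_mem Dv|Dv].
    have -> : (fun y => ((g \o Phi) \_ (Phi @^-1` E)) (v, y)) =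
        (cst (g (tau v))) \_ `]0, w v[.
      apply/funext => y; rewrite !patchE /Phi /b /=.
      have -> : (y \in `]0, w v[%classic) = (0 < y < w v).
        by apply/idP/idP; rewrite inE/= in_itv.
      have [yw|yw] := boolP (0 < y < w v).
        rewrite ifT; last first.
          by apply/mem_set; rewrite /= /Phi /b/= yw (mem_set Dv); exact: DE.
        by rewrite (mem_set Dv).
      rewrite ifF//; apply/negbTE/negP => /set_mem/=.
      by rewrite /Phi /b /= (negbTE yw) andbF.
    transitivity (\int[mu]_(y in `]0%R, w v[) cst (g (tau v)) y)%E.
      by rewrite [RHS]integral_mkcond.
    rewrite integral_cst//= lebesgue_measure_itv/= lte_fin.
    case: ifPn; first by rewrite sube0.
    rewrite -leNgt => w0'; have -> : w v = 0 by apply/le_anti; rewrite w0' w0.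
    by [].
  apply: integral0_eq => y _; rewrite patchE ifF//.
  apply/negbTE/negP => /set_mem/=.
  by rewrite /Phi /b/= (negbTE Dv).
move=> g mg g0; rewrite -nuE//.
have nu_set A : measurable A -> nu (E `&` A) =
    (\int[mu]_(v in D `&` [set v | A (tau v)]) (w v)%:E)%E.
  move=> mA; have mEA := measurableI _ _ mE mA.
  transitivity (\int[nu]_(t in E) (\1_A t)%:E)%E.
    by rewrite integral_indic// setIC.
  rewrite nuE//; last by apply/measurable_EFinP; exact: measurable_indic.
  rewrite [RHS]integral_mkcondr; apply: eq_integral => v _.
  rewrite patchE indicE.
  have -> : (v \in [set v | A (tau v)]) = (tau v \in A).
    by apply/idP/idP => /set_mem/= ?; apply/mem_set.
  by case: (_ \in _); rewrite ?mul1e ?mul0e.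
(* Restriction to [E] makes both measures finite, as the comparison on rays requires. *)
pose m1 : {measure set (measurableTypeR R) -> \bar R} := mrestr mu mE.
pose m2 : {measure set (measurableTypeR R) -> \bar R} := mrestr nu mE.
apply: eq_measure_integral => A mA AE.
have E12 : m1 setT = m2 setT.
  rewrite /m1 /m2 /= /mrestr setTI muE.
  have := nu_set setT measurableT; rewrite setIT => ->.
  by congr (integral _ _ _); apply/seteqP; split => [v Dv|v []].
have m12 (x : R) : m1 `]-oo, x[%classic = m2 `]-oo, x[%classic.
  have -> : `]-oo, x[%classic = [set t : R | t < x].
    by apply/seteqP; split => t /=; rewrite in_itv.
  have mI : measurable [set t : R | t < x].
    rewrite (_ : mkset _ = `]-oo, x[%classic); first exact: measurable_itv.
    by apply/seteqP; split => t /=; rewrite in_itv.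
  have e1 : m1 [set t : R | t < x] = mu (E `&` [set t : R | t < x]).
    by rewrite /m1/= /mrestr setIC.
  have e2 : m2 [set t : R | t < x] = nu (E `&` [set t : R | t < x]).
    by rewrite setIC.
  by rewrite e1 e2 muEx (nu_set _ mI).
have m1oo : (m1 setT < +oo)%E by rewrite /m1/= /mrestr setTI.
have := finite_measure_eq_rays E12 m1oo m12 mA.
have e1 : m1 A = mu A by rewrite -[in RHS](setIidl AE).
have e2 : m2 A = nu A by rewrite -[in RHS](setIidl AE).
by rewrite e1 e2.
Qed.

(** * The substitution [t = 1 / (1 + v)] and its inverse *)

Lemma integral_inv_sqr1p (a : R) : 0 <= a ->
  (\int[mu]_(v in `[a, +oo[) ((1 + v) ^- 2)%:E = ((1 + a)^-1)%:E)%E.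
Proof.
move=> a0.
have pos v : a <= v -> 0 < 1 + v by move=> av; rewrite ltr_pwDl// (le_trans a0).
have dF v : a <= v -> is_derive v 1 (fun v : R => - (1 + v)^-1) ((1 + v) ^- 2).
  move=> av; have n0 := gt_eqF (pos _ av).
  have d1 : is_derive v 1 (fun v : R => 1 + v) 1.
    by have := is_deriveD (is_derive_cst (1 : R) v 1) (is_derive_id v 1); rewrite add0r.
  have d2 := is_deriveV (negbT n0) d1.
  by apply: is_derive_eq; rewrite /GRing.scale/= mulr1 opprK.
rewrite (@ge0_continuous_FTC2y _ _ (fun v => - (1 + v)^-1) _ 0).
- by rewrite -EFinB sub0r opprK.
- by move=> v av; rewrite invr_ge0 exprn_ge0// ltW// pos.
- apply: continuous_in_subspaceT => v /set_mem/=; rewrite in_itv/= andbT => av.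
  have n0 := gt_eqF (pos _ av).
  apply: cvgV; first by rewrite expf_neq0// n0.
  apply: (is_derive_continuous (f := fun v : R => (1 + v) ^+ 2) (df := 2 * (1 + v))).
  by apply: is_derive_eq; rewrite /GRing.scale/=; ring.
- rewrite -[0]oppr0; apply: cvgN; apply/gtr0_cvgV0.
    by near=> v; rewrite ltr_pwDl//; near: v; exact: nbhs_pinfty_ge.
  apply/cvgryPge => A; near=> v.
  rewrite -lerBlDl; near: v; apply: nbhs_pinfty_ge; exact: num_real.
- by move=> v av; have [] := dF _ (ltW av).
- apply: cvg_at_right_filter; exact: is_derive_continuous (dF _ (lexx a)).
- by move=> v; rewrite in_itv/= andbT => av; rewrite derive1E; have [_] := dF _ (ltW av).
Unshelve. all: end_near. Qed.

(** For [0 < x < 1] the condition [1 / (1 + v) < x] means [v > 1 / x - 1], and [(1 + v)^-2] has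
    integral [x] over that ray, the length of []0, x[]. Rays ending outside []0, 1[] give nothing or
    everything. *)
Lemma ge0_integral_inv1p (g : R -> \bar R) :
  measurable_fun setT g -> (forall t, 0 <= g t)%E ->
  (\int[mu]_(t in `]0%R, 1%R[) g t =
   \int[mu]_(v in `]0%R, +oo[) (g (1 + v)^-1%R * ((1 + v) ^- 2)%:E))%E.
Proof.
have m1p : measurable_fun setT (fun v : R => 1 + v) by exact: measurable_funD.
have mtau : measurable_fun setT (fun v : R => (1 + v)^-1) by exact: measurable_funV.
have mw : measurable_fun setT (fun v : R => (1 + v) ^- 2).
  by apply: measurable_funV; exact: measurable_funX.
have obnd (a : R) : 0 <= a ->
   (\int[mu]_(v in `]a, +oo[) ((1 + v) ^- 2)%:E = ((1 + a)^-1)%:E)%E.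
  move=> a0; rewrite integral_itv_obnd_cbnd ?integral_inv_sqr1p//.
  by apply/measurable_EFinP; exact: measurable_funTS.
have mu01 : mu `]0%R, 1%R[ = 1%E by rewrite lebesgue_measure_itv/= lte_fin ltr01 sube0.
apply: (@ge0_integral_change_of_variables _ _ (fun v => (1 + v)^-1) _ 0) => //.
- by move=> v _; rewrite invr_ge0 sqr_ge0.
- move=> v /=; rewrite !in_itv/= andbT => v0.
  by rewrite invr_gt0 invf_lt1 ?addr_gt0//= ltrDl v0.
- by rewrite /= in_itv/= ltxx.
- by rewrite mu01 ltry.
- by rewrite mu01 obnd// addr0 invr1.
move=> x; have [x0|x0] := leP x 0.
  rewrite (_ : _ `&` _ = set0); last first.
    apply/seteqP; split => t //=; rewrite in_itv/= => -[/andP[t0 _] tx].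
    by have := lt_trans t0 (lt_le_trans tx x0); rewrite ltxx.
  rewrite measure0 (_ : _ `&` _ = set0) ?integral_set0//.
  apply/seteqP; split => v //=; rewrite in_itv/= andbT => -[v0 vx].
  have : 0 < (1 + v)^-1 by rewrite invr_gt0 addr_gt0.
  by move=> /lt_trans /(_ (lt_le_trans vx x0)); rewrite ltxx.
have [x1|x1] := leP 1 x.
  rewrite (_ : _ `&` _ = `]0%R, 1%R[%classic); last first.
    apply/seteqP; split => t /=; rewrite in_itv/=; first by case.
    by move=> /andP[t0 t1]; rewrite t0 t1; split => //; exact: lt_le_trans x1.
  rewrite (_ : `]0%R, +oo[%classic `&` _ = `]0%R, +oo[%classic).
    by rewrite mu01 obnd// addr0 invr1.
  apply/seteqP; split => v /=; rewrite in_itv/= andbT; first by case.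
  move=> v0; split=> //; apply: lt_le_trans x1.
  by rewrite invf_lt1 ?addr_gt0//= ltrDl v0.
rewrite (_ : _ `&` _ = `]0%R, x[%classic); last first.
  apply/seteqP; split => t /=; rewrite !in_itv/=; first by move=> [/andP[-> _] ->].
  by move=> /andP[t0 tx]; rewrite t0 (lt_trans tx).
rewrite lebesgue_measure_itv/= lte_fin x0 sube0.
rewrite (_ : _ `&` _ = `](x^-1 - 1), +oo[%classic); last first.
  apply/seteqP; split => v /=; rewrite !in_itv/= !andbT.
    move=> [v0]; rewrite -ltf_pV2 ?posrE ?invr_gt0 ?addr_gt0// invrK => h.
    by rewrite ltrBlDl.
  move=> xv; have v0 : 0 < v.
    by apply: le_lt_trans xv; rewrite subr_ge0 invf_ge1// ltW.
  split=> //; rewrite -ltf_pV2 ?posrE ?invr_gt0 ?addr_gt0// invrK.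
  by rewrite -ltrBlDl.
rewrite obnd; first by rewrite addrC subrK invrK.
by rewrite subr_ge0 invf_ge1// ltW.
Qed.

(** The preceding substitution applied to [H((1 - t) / t) t^-2], whose factor [t^-2] cancels
    [(1 + v)^-2]. *)
Lemma ge0_integral_onem_div (H : R -> \bar R) :
  measurable_fun (`]0, +oo[ : set R) H -> (forall v, (0 < v)%R -> 0 <= H v)%E ->
  (\int[mu]_(v in `]0%R, +oo[) H v =
   \int[mu]_(t in `]0%R, 1%R[) (H ((1 - t) / t)%R * (t ^- 2)%:E))%E.
Proof.
move=> mH H0.
pose H' := H \_ `]0%R, +oo[.
have mH' : measurable_fun setT H' by apply/(measurable_restrictT _ _).1.
have H'0 v : (0 <= H' v)%E.
  by apply: erestrict_ge0 => u /=; rewrite in_itv/= andbT => /H0.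
have E v : 0 < v -> H v = H' v.
  by move=> v0; rewrite /H' patchE mem_set//= in_itv/= v0.
have mV : measurable_fun setT (fun t : R => t^-1) by exact: measurable_funV.
pose g t := (H' ((1 - t) / t)%R * (t ^- 2)%:E)%E.
have mg : measurable_fun setT g.
  apply: emeasurable_funM.
    by apply: measurableT_comp => //; apply: measurable_funM => //; exact: measurable_funB.
  by apply/measurable_EFinP; apply: measurable_funV; exact: measurable_funX.
transitivity (\int[mu]_(t in `]0%R, 1%R[) g t)%E; last first.
  apply: eq_integral => t /set_mem/=; rewrite in_itv/= => /andP[t0 t1].
  by rewrite /g E// divr_gt0// subr_gt0.
rewrite ge0_integral_inv1p//; last first.
  by move=> t; rewrite mule_ge0// lee_fin invr_ge0 sqr_ge0.
apply: eq_integral => v /set_mem/=; rewrite in_itv/= andbT => v0.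
have v1 : 1 + v != 0 by rewrite gt_eqF// addr_gt0.
rewrite /g exprVn invrK -muleA -EFinM divff ?expf_neq0// mule1 E//.
by congr H'; field.
Qed.

End change_of_variables.

(** * Laplace transforms of functions on the unit interval *)

Section laplace_unit_interval.
Context {R : realType}.
Notation mu := (@lebesgue_measure R).
Notation I01 := (`]0%R, 1%R[%classic : set R).
Implicit Types (f w : R -> R) (s t : R).

Lemma near_gt0 s (P : R -> Prop) : 0 < s -> (forall u, 0 < u -> P u) ->
  \forall u \near s, P u.
Proof. by move=> s0 HP; apply: filterS (open_gt s0) => u; exact: HP. Qed.

(** If the weighted integral were zero, [w f] and hence [f] would vanish almost everywhere on
    [D]. *)
Lemma integral_weight_gt0 (D : set R) f w : measurable D ->
  measurable_fun D f -> measurable_fun D w ->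
  (forall t, D t -> 0 <= f t) -> (forall t, D t -> 0 < w t) ->
  (0 < \int[mu]_(t in D) (f t)%:E)%E ->
  (0 < \int[mu]_(t in D) (w t * f t)%:E)%E.
Proof.
move=> mD mf mw f0 w0 If.
have wf0 t : D t -> (0 <= (w t * f t)%:E)%E.
  by move=> Dt; rewrite lee_fin mulr_ge0 ?f0// ltW ?w0.
rewrite lt0e integral_ge0// andbT; apply/negP => /eqP Iwf.
have mwf : measurable_fun D (fun t => (w t * f t)%:E).
  by apply/measurable_EFinP; exact: measurable_funM.
have : (\int[mu]_(t in D) `|(w t * f t)%:E| = 0)%E.
  by rewrite -[RHS]Iwf; apply: eq_integral => t /set_mem Dt; rewrite gee0_abs ?wf0.
move=> /(ae_eq_integral_abs mu mD mwf) wf_ae.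
have : ae_eq mu D (fun t => (f t)%:E) (cst 0%E).
  apply: filterS wf_ae => t /= wf Dt; have := wf Dt.
  move=> [] /eqP; rewrite mulf_eq0 gt_eqF ?w0//= => /eqP ->.
  by [].
move=> /ae_eq_integral => /(_ mD) H; move: If.
by rewrite H ?integral0 ?ltxx//; exact/measurable_EFinP.
Qed.

(** Meaningful for every real [s] when [f] is integrable on []0, 1[]; in particular it is
    differentiable across [s = 0], the value that corresponds to [x = 0]. *)
Definition laplace01 f s : R := \int[mu]_(t in I01) (expR (- s * t) * f t).

Let mI01 : measurable I01. Proof. exact: measurable_itv. Qed.

Lemma integrable_bounded_mul f w (C : R) : measurable_fun I01 w ->
  (forall t, I01 t -> `|w t| <= C) ->
  mu.-integrable I01 (EFin \o f) ->
  mu.-integrable I01 (EFin \o (fun t => w t * f t)).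
Proof.
move=> mw wC intf.
have mf : measurable_fun I01 f by apply/measurable_EFinP; exact: measurable_int intf.
apply: (@le_integrable _ _ _ mu I01 mI01 _ (fun t => (C%:E * `|(f t)%:E|)%E)).
- by apply/measurable_EFinP; exact: measurable_funM.
- move=> t It /=; rewrite lee_fin !normrM normr_id ler_wpM2r//.
  exact: le_trans (wC t It) (ler_norm _).
- by apply: integrableZl => //; exact: integrable_abse intf.
Qed.

Lemma expR_bound01 s t : I01 t -> expR (- s * t) <= expR `|s|.
Proof.
rewrite /= in_itv/= => /andP[t0 t1]; rewrite ler_expR.
apply: (le_trans (ler_norm _)); rewrite normrM normrN (gtr0_norm t0).
by rewrite ler_piMr// ltW.
Qed.

Lemma measurable_expRM s (D : set R) : measurable_fun D (fun t => expR (- s * t)).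
Proof.
apply: measurable_funTS; apply: (measurableT_comp (@measurable_expR R)).
exact: measurable_funM.
Qed.

Lemma integrable_laplace01 f s : mu.-integrable I01 (EFin \o f) ->
  mu.-integrable I01 (EFin \o (fun t => expR (- s * t) * f t)).
Proof.
apply: (@integrable_bounded_mul _ _ (expR `|s|)); first exact: measurable_expRM.
by move=> t It; rewrite ger0_norm ?expR_ge0// expR_bound01.
Qed.

Lemma integrable_mulid01 f : mu.-integrable I01 (EFin \o f) ->
  mu.-integrable I01 (EFin \o (fun t => t * f t)).
Proof.
apply: (@integrable_bounded_mul _ _ 1) => // t /=; rewrite in_itv/= => /andP[t0 t1].
by rewrite ger0_norm ltW.
Qed.

(** For [x] within distance one of [s] and [t] in []0, 1[], the differentiated kernel is at most
    [exp(|s| + 1)], so [exp(|s| + 1) |f|] dominates. *)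
Lemma is_derive_laplace01 f s : mu.-integrable I01 (EFin \o f) ->
  is_derive s 1 (laplace01 f) (- laplace01 (fun t => t * f t) s).
Proof.
move=> intf.
pose k x t := expR (- x * t) * f t.
have dk (x t : R) : is_derive x 1 (k^~ t) (- t * expR (- x * t) * f t).
  have d1 : is_derive x 1 (fun x : R => - x * t) (- t).
    by apply: is_derive_eq; rewrite /GRing.scale/=; ring.
  have d2 := @is_derive1_comp _ expR (fun x : R => - x * t) _ _ _
    (is_derive_expR (- x * t)) d1.
  by apply: is_derive_eq; rewrite /GRing.scale/=; ring.
have pk x t : partial1of2 k x t = - t * expR (- x * t) * f t.
  by rewrite partial1of2E; have [_] := dk x t.
pose G t := expR (`|s| + 1) * `|f t|.
have G0 t : 0 <= G t by rewrite mulr_ge0 ?expR_ge0.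
have intG : mu.-integrable I01 (EFin \o G).
  apply: (@integrable_bounded_mul (fun t => `|f t|) (cst (expR (`|s| + 1))) (expR (`|s| + 1))).
  - exact: measurable_cst.
  - by move=> t _; rewrite ger0_norm ?expR_ge0.
  - exact: integrable_norm intf.
have sI : `]s - 1, s + 1[%classic s by rewrite /= in_itv/= ltrBlDr ltrDl ltr01.
have kI x : `]s - 1, s + 1[%classic x -> mu.-integrable I01 (EFin \o k x).
  by move=> _; exact: integrable_laplace01.
have dk1 x t : `]s - 1, s + 1[%classic x -> I01 t -> derivable (k^~ t) x 1.
  by move=> _ _; have [] := dk x t.
have kG x t : `]s - 1, s + 1[%classic x -> I01 t -> `|partial1of2 k x t| <= G t.
  move=> xs It; rewrite pk !normrM normrN.
  rewrite /G ler_wpM2r// (ger0_norm (expR_ge0 _)).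
  apply: (@le_trans _ _ (1 * expR `|x|)).
    rewrite ler_pM ?expR_ge0// ?expR_bound01//.
    by move: It; rewrite /= in_itv/= => /andP[t0 t1]; rewrite ger0_norm ltW.
  rewrite mul1r ler_expR.
  move: xs; rewrite /= in_itv/= => /andP[x1 x2].
  have : `|x - s| <= 1 by rewrite ler_norml; lra.
  by have := ler_normD (x - s) s; rewrite subrK; lra.
apply: DeriveDef.
  exact: (@derivable_under_integral _ _ _ mu k _ mI01 _ _ _ sI kI dk1 G G0 intG kG).
have := @differentiation_under_integral _ _ _ mu k _ mI01 _ _ _ sI kI dk1 G G0 intG kG.
rewrite derive1E => ->.
rewrite /laplace01 -mulN1r -RintegralZl//; last first.
  by apply: integrable_laplace01; exact: integrable_mulid01.
by apply: eq_Rintegral => t _; rewrite pk; ring.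
Qed.

Section positive.
Variable f : R -> R.
Hypothesis intf : mu.-integrable I01 (EFin \o f).
Hypothesis f0 : forall t, I01 t -> 0 <= f t.
Hypothesis If : (0 < \int[mu]_(t in I01) (f t)%:E)%E.

Let mf : measurable_fun I01 f.
Proof. by apply/measurable_EFinP; exact: measurable_int intf. Qed.

Lemma laplace01_gt0 s : 0 < laplace01 f s.
Proof.
have h := integrable_laplace01 s intf.
rewrite /laplace01 /Rintegral fine_gt0//; apply/andP; split.
  by apply: integral_weight_gt0 => // [|t _]; [exact: measurable_expRM|exact: expR_gt0].
by rewrite ltey_eq integrable_fin_num.
Qed.

Lemma laplace01_mulid_le s : laplace01 (fun t => t * f t) s <= laplace01 f s.
Proof.
apply: le_Rintegral => //.
- by apply: integrable_laplace01; exact: integrable_mulid01.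
- exact: integrable_laplace01.
- move=> t It; rewrite ler_wpM2l ?expR_ge0// ler_piMl ?f0//.
  by move: It; rewrite /= in_itv/= => /andP[_ /ltW].
Qed.

Lemma integral_mulid01_gt0 : (0 < \int[mu]_(t in I01) (t * f t)%:E)%E.
Proof.
apply: integral_weight_gt0 => // t.
by rewrite /= in_itv/= => /andP[].
Qed.

End positive.

Lemma laplace01_minimax (k : nat) f (G : R -> R) :
  mu.-integrable I01 (EFin \o f) -> (forall t, I01 t -> 0 <= f t) ->
  (0 < \int[mu]_(t in I01) (f t)%:E)%E ->
  (forall s, 0 < s -> G s = laplace01 f s) ->
  minimaxity_condition k G ->
  minimax (fun x : 'rV[R]_k =>
    x + - (laplace01 (fun t => t * f t) (sqnorm x / 2) /
           laplace01 f (sqnorm x / 2)) *: x).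
Proof.
move=> intf f0 If GL cond.
pose f1 t := t * f t; pose f2 t := t * f1 t.
have intf1 : mu.-integrable I01 (EFin \o f1) by exact: integrable_mulid01.
have intf2 : mu.-integrable I01 (EFin \o f2) by exact: integrable_mulid01.
have f10 t : I01 t -> 0 <= f1 t.
  by move=> It; rewrite mulr_ge0 ?f0//; move: It; rewrite /= in_itv/= => /andP[/ltW].
have f20 t : I01 t -> 0 <= f2 t.
  by move=> It; rewrite mulr_ge0 ?f10//; move: It; rewrite /= in_itv/= => /andP[/ltW].
have If1 := integral_mulid01_gt0 intf f0 If.
have If2 := integral_mulid01_gt0 intf1 f10 If1.
pose L0 := laplace01 f; pose L1 := laplace01 f1; pose L2 := laplace01 f2.
have L0_gt0 s : 0 < L0 s by exact: laplace01_gt0.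
have L1_gt0 s : 0 < L1 s by exact: laplace01_gt0.
have L2_gt0 s : 0 < L2 s by exact: laplace01_gt0.
have L0n s : L0 s != 0 by rewrite gt_eqF.
have L10 s : L1 s <= L0 s by exact: laplace01_mulid_le.
have L21 s : L2 s <= L1 s by exact: laplace01_mulid_le.
have dL0 s : is_derive s 1 L0 (- L1 s) by exact: is_derive_laplace01.
have dL1 s : is_derive s 1 L1 (- L2 s) by exact: is_derive_laplace01.
(* A third derivative enters only to make [L2], and with it [dpsi], continuous. *)
have dL2 s : is_derive s 1 L2 (- laplace01 (fun t => t * f2 t) s).
  exact: is_derive_laplace01.
pose psi s := - (L1 s / L0 s).
pose dpsi s := L2 s / L0 s - (L1 s / L0 s) ^+ 2.
have dpsiE (s : R) : is_derive s 1 psi (dpsi s).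
  have dV := is_deriveV (L0n s) (dL0 s).
  by apply: is_derive_eq; rewrite /GRing.scale/= /dpsi; field.
have cL0 s : {for s, continuous L0} by exact: is_derive_continuous (dL0 s).
have cL1 s : {for s, continuous L1} by exact: is_derive_continuous (dL1 s).
have cL2 s : {for s, continuous L2} by exact: is_derive_continuous (dL2 s).
have cdpsi : continuous dpsi.
  have cV s : {for s, continuous (fun s => (L0 s)^-1)} by exact: is_derive_continuous (is_deriveV (L0n s) (dL0 s)).
  have cq s : {for s, continuous (fun s => L1 s / L0 s)}.
    by apply: cvgM; [exact: cL1|exact: cV].
  move=> s; apply: cvgB; first by apply: cvgM; [exact: cL2|exact: cV].
  under eq_fun do rewrite expr2.
  by rewrite expr2; apply: cvgM; exact: cq.
have a01 s : 0 < L1 s / L0 s <= 1.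
  by rewrite divr_gt0//= ler_pdivrMr// mul1r.
have b01 s : 0 < L2 s / L0 s <= 1.
  by rewrite divr_gt0//= ler_pdivrMr// mul1r (le_trans (L21 s)).
apply: (@shrinkage_minimax _ _ psi dpsi) => //.
- by move=> s _; rewrite /psi normrN ger0_norm; have /andP[? ?] := a01 s => //; exact: ltW.
- move=> s _; rewrite /dpsi ler_norml; have /andP[a0 a1] := a01 s; have /andP[b0 b1] := b01 s.
  by apply/andP; split; nra.
(* The minimaxity condition says nothing at [s = 0], where the inequality reduces to
   [2 k psi(0) <= 0]. *)
move=> s; rewrite le_eqVlt => /predU1P[<-|s0].
  have /andP[a0 a1] := a01 0.
  have -> : 2 * k%:R * psi 0 + 4 * 0 * dpsi 0 + 2 * 0 * psi 0 ^+ 2 =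
    - (2 * k%:R * (L1 0 / L0 0)) by rewrite /psi; ring.
  by rewrite oppr_le0 mulr_ge0 ?(ltW a0)// mulr_ge0.
have G1 u : 0 < u -> G^`()%classic u = - L1 u.
  move=> u0; rewrite derive1E.
  have : \forall z \near u, G z = L0 z.
    by apply: (near_gt0 u0) => z; exact: GL.
  move=> e; transitivity ('D_1 L0 u); first exact: near_eq_derive e.
  by have [_] := dL0 u.
have G2 : G^`(2)%classic s = L2 s.
  rewrite derive1nS derive1E.
  have : \forall z \near s, G^`(1)%classic z = - L1 z.
    by apply: (near_gt0 s0) => z z0; rewrite derive1n1; exact: G1.
  move=> e; transitivity ('D_1 (fun z => - L1 z) s); first exact: near_eq_derive e.
  have dN : is_derive s 1 (fun z => - L1 z) (L2 s).
    by apply: is_derive_eq; rewrite opprK.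
  by have [_] := dN.
have := cond s s0; rewrite G1// G2 GL// -/(L0 s).
have /andP[a0 a1] := a01 s.
have L1n : L1 s != 0 by rewrite gt_eqF.
have -> : L2 s / - L1 s = - (L2 s / L0 s) / (L1 s / L0 s).
  by field; rewrite L0n L1n.
rewrite mulNr /psi /dpsi.
move: (L1 s / L0 s) (L2 s / L0 s) a0 a1 => a b a0 a1.
rewrite ler_pdivlMr// => h.
(* Here [a = - G' / G] and [b = G'' / G]; the condition reads [- a + 2 b / a <= k / s] and is
   multiplied by [s a > 0]. *)
have h2 : 2 * (s * b) <= k%:R * a + s * a ^+ 2.
  have : (- a - 2 * (- b / a)) * s * a <= k%:R * a by rewrite ler_pM2r.
  have -> : (- a - 2 * (- b / a)) * s * a = - (s * a ^+ 2) + 2 * (s * b).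
    by field; rewrite gt_eqF.
  by rewrite addrC lerBlDr.
have -> : 2 * k%:R * - a + 4 * s * (b - a ^+ 2) + 2 * s * (- a) ^+ 2 =
  2 * (2 * (s * b) - (k%:R * a + s * a ^+ 2)) by ring.
by rewrite pmulr_rle0// subr_le0.
Qed.

(** The hypothesis at [s = 1] makes [exp(- t) f] integrable; multiplying back by [exp t], bounded on
    []0, 1[], gives the integrability of [f] itself. *)
Lemma is_laplace_transform01 f (G : R -> R) : (forall t, 1 <= t -> f t = 0) ->
  is_laplace_transform f G ->
  mu.-integrable I01 (EFin \o f) /\ forall s, 0 < s -> G s = laplace01 f s.
Proof.
move=> f1 LG.
have sub : I01 `<=` `]0, +oo[ by apply: subset_itvl; rewrite bnd_simp.
split; last first.
  move=> s s0; have [_ <-] := LG s s0.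
  rewrite /laplace01 Rintegral_mkcond [RHS]Rintegral_mkcond.
  apply: eq_Rintegral => t _; rewrite !patchE.
  case: ifPn => [/set_mem t0|t0].
    case: ifPn => // t1; rewrite f1 ?mulr0// leNgt; apply: contra t1 => t1.
    by rewrite inE/= in_itv/= t1 andbT; move: t0; rewrite /= in_itv/= andbT.
  case: ifPn => // /set_mem/sub t1.
  by move/negP: t0 => []; exact/mem_set.
have [int1 _] := LG 1 ltr01.
have mIpos : measurable (`]0, +oo[%classic : set R) by exact: measurable_itv.
have := @integrableS _ _ _ mu _ I01 _ mIpos mI01 sub int1.
move=> /(@integrable_laplace01 _ (- 1)); apply: eq_integrable => //.
by move=> t _ /=; rewrite mulrA -expRD opprK mul1r mulN1r addrN expR0 mul1r.
Qed.

End laplace_unit_interval.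

(** * Marginals and Bayes estimators *)

Section bayes.
Context {R : realType} {k : nat}.
Notation mu := (@lebesgue_measure R).
Notation I01 := (`]0%R, 1%R[%classic : set R).
Notation Ipos := (`]0%R, +oo[%classic : set R).
Implicit Types (h : R -> R) (x theta : 'rV[R]_k).

Lemma laplace_density_ge1 h t : 1 <= t -> laplace_density k h t = 0.
Proof.
move=> t1; rewrite /laplace_density indicE memNset ?mulr0//=.
by rewrite in_itv/= => /andP[_]; rewrite ltNge t1.
Qed.

Lemma laplace_density01 h t : I01 t ->
  laplace_density k h t = t `^ (k%:R / 2 - 2) * h ((1 - t) / t).
Proof. by move=> It; rewrite /laplace_density indicE mem_set// mulr1. Qed.

Lemma powR_sub2 (t r : R) : 0 < t -> t `^ (r - 2) = t `^ r / t ^+ 2.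
Proof.
move=> t0; rewrite powRB; last by rewrite (gt_eqF t0) implybT.
by congr (_ / _); exact: (powR_mulrn 2 (ltW t0)).
Qed.

(** The origin of the exponent [k / 2 - 2] in [f]: with [1 + v = 1 / t], the normalizing constant
    contributes [t^(k / 2)] and the change of variables [t^-2]. *)
Lemma normal_density_onem_div x t : I01 t ->
  normal_density 0 (1 + (1 - t) / t) x * t ^- 2 =
  (2 * pi) `^ (- (k%:R / 2)) *
  (expR (- (sqnorm x / 2) * t) * t `^ (k%:R / 2 - 2)).
Proof.
rewrite /= in_itv/= => /andP[t0 t1].
have tn : t != 0 by rewrite gt_eqF.
have -> : 1 + (1 - t) / t = t^-1 by field.
rewrite /normal_density subr0 powRM ?mulr_ge0 ?pi_ge0 ?invr_ge0 ?(ltW t0)//.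
have -> : t^-1 `^ (- (k%:R / 2)) = t `^ (k%:R / 2).
  by rewrite -powR_inv1 ?(ltW t0)// -powRrM mulN1r opprK.
have -> : sqnorm x / (2 * t^-1) = (sqnorm x / 2) * t by field.
by rewrite powR_sub2// mulNr; ring.
Qed.

(* Tonelli's theorem and the substitution [t = 1 / (1 + v)]. *)
Lemma marginalE h x : measurable_fun Ipos h -> (forall v, 0 < v -> 0 <= h v) ->
  marginal h x = (\int[mu]_(t in I01) ((2 * pi) `^ (- (k%:R / 2)) *
    (expR (- (sqnorm x / 2) * t) * laplace_density k h t))%:E)%E.
Proof.
move=> mh h0.
pose h' := h \_ Ipos.
have mh' : measurable_fun setT h' by apply/(measurable_restrictT _ _).1.
have h'0 v : 0 <= h' v.
  by rewrite /h' patchE; case: ifPn => // /set_mem/=; rewrite in_itv/= andbT => /h0.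
pose F (z : 'rV[R]_k * R) : \bar R :=
  (normal_density z.1 1 x * (normal_density 0 z.2 z.1 * h' z.2))%:E.
have mF : measurable_fun setT F.
  apply/measurable_EFinP; apply: measurable_funM.
    by apply: measurable_normal_density => //; exact: measurable_fst.
  apply: measurable_funM.
    exact: measurable_normal_density.
  by apply: measurableT_comp => //; exact: measurable_snd.
have F0 z : (0 <= F z)%E.
  rewrite /F lee_fin; apply: mulr_ge0; first exact: normal_density_ge0.
  by apply: mulr_ge0 => //; exact: normal_density_ge0.
have mnd w y : measurable_fun setT (fun t : 'rV[R]_k => normal_density y w t).
  exact: measurable_normal_density.
transitivity (\int[lebesgue_rV k]_theta \int[mu]_v F (theta, v))%E.
  apply: eq_integral => theta _; rewrite /mixture_prior integral_mkcond.
  rewrite -ge0_integralZl//.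
  - apply: eq_integral => v _; rewrite /F/= /h' !patchE.
    by case: ifPn => _; rewrite ?mulr0 ?mule0// EFinM.
  - apply/(measurable_restrictT _ _).1 => //; apply/measurable_EFinP.
    apply: measurable_funM => //.
    by apply: measurable_funTS; exact: measurable_normal_density.
  - move=> v _; rewrite patchE; case: ifPn => // /set_mem/=; rewrite in_itv/= andbT => v0.
    by rewrite lee_fin mulr_ge0 ?h0//; exact: normal_density_ge0.
  - by rewrite lee_fin; exact: normal_density_ge0.
rewrite fubini_tonelli//.
(* The posterior density integrates to one, so integrating [theta] out leaves the law
   [N(0, (1 + v) I)] of [X] given the variance [v]. *)
transitivity (\int[mu]_(v in Ipos) (normal_density 0 (1 + v) x * h v)%:E)%E.
  rewrite [RHS]integral_mkcond; apply: eq_integral => v _; rewrite patchE.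
  case: ifPn => [v0|v0]; last first.
    apply: integral0_eq => theta _; rewrite /F/= /h' patchE (negbTE v0).
    by rewrite !mulr0.
  have hE : h' v = h v by rewrite /h' patchE v0.
  have {}v0 : 0 < v by move: v0; rewrite inE/= in_itv/= andbT.
  have c0 : 0 < v / (1 + v) by rewrite divr_gt0// addr_gt0.
  rewrite -[RHS]mule1 -(integral_normal_density ((v / (1 + v)) *: x) c0).
  rewrite -ge0_integralZl//.
  - apply: eq_integral => theta _; rewrite /F/= hE -EFinM; congr EFin.
    by rewrite mulrA normal_density_posterior// mulrAC.
  - by apply/measurable_EFinP; exact: mnd.
  - by move=> theta _; rewrite lee_fin; exact: normal_density_ge0.
  - by rewrite lee_fin mulr_ge0 ?h0//; exact: normal_density_ge0.
rewrite ge0_integral_onem_div; last 2 first.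
- apply/measurable_EFinP; apply: measurable_funM => //; apply: measurable_funTS.
  by apply: measurable_normal_density => //; exact: measurable_funD.
- by move=> v v0; rewrite lee_fin mulr_ge0 ?h0//; exact: normal_density_ge0.
apply: eq_integral => t /set_mem It.
rewrite -EFinM laplace_density01//; congr EFin.
by rewrite mulrAC normal_density_onem_div// -!mulrA.
Qed.

Lemma sqnorm_add_delta x (i : 'I_k) (u : R) :
  sqnorm (u *: delta_mx 0 i + x) = sqnorm x + (2 * u * x 0 i + u ^+ 2).
Proof.
rewrite /sqnorm (bigD1 i)//= [in RHS](bigD1 i)//= !mxE !eqxx /= mulr1.
rewrite (eq_bigr (fun j => x 0 j ^+ 2)); first by ring.
by move=> j ji; rewrite !mxE (negbTE ji) andbF mulr0 add0r.
Qed.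

(** Turns a directional derivative into a derivative in one real variable, where the one-variable
    chain rule applies. *)
Lemma derive_line (F : 'rV[R]_k -> R) x v (df : R) :
  is_derive (0 : R) 1 (fun u : R => F (u *: v + x)) df -> 'D_v F x = df.
Proof.
move=> [_ <-]; rewrite /derive.
have -> : (fun u : R => u^-1 *: ((F \o shift x) (u *: v) - F x)) =
    (fun u : R => u^-1 *: (((fun u : R => F (u *: v + x)) \o shift 0) (u *: 1) -
      F (0 *: v + x))).
  apply/funext => u /=; rewrite scale0r add0r.
  by congr (_ *: (F (_ *: _ + _) - _)); rewrite addr0 /GRing.scale/= mulr1.
by [].
Qed.

(** Along the [i]-th axis [|x|^2 / 2] has derivative [x_i], so [log m] has derivative
    [(G' / G) x_i]; the constant [c] cancels in the quotient. *)
Lemma bayes_estimatorE h x : mixing_density h ->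
  mu.-integrable I01 (EFin \o laplace_density k h) ->
  (0 < \int[mu]_(t in I01) (laplace_density k h t)%:E)%E ->
  bayes_estimator h x =
    x + - (laplace01 (fun t => t * laplace_density k h t) (sqnorm x / 2) /
           laplace01 (laplace_density k h) (sqnorm x / 2)) *: x.
Proof.
move=> [mh h0 _] intf If.
set f := laplace_density k h in intf If *.
have f0 t : I01 t -> 0 <= f t.
  move=> It; rewrite /f laplace_density01// mulr_ge0 ?powR_ge0// h0//.
  by move: It; rewrite /= in_itv/= => /andP[t0 t1]; rewrite divr_gt0// subr_gt0.
pose c : R := (2 * pi) `^ (- (k%:R / 2)).
have c0 : 0 < c by rewrite powR_gt0// mulr_gt0// pi_gt0.
have mE (y : 'rV[R]_k) : fine (marginal h y) = c * laplace01 f (sqnorm y / 2).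
  rewrite marginalE// -/f -/c /laplace01 -RintegralZl//; exact: integrable_laplace01.
have L0 s : 0 < laplace01 f s by exact: laplace01_gt0.
congr (x + _); apply/rowP => i; rewrite !mxE.
apply: derive_line.
under eq_fun do rewrite mE sqnorm_add_delta.
pose S (u : R) := (sqnorm x + (2 * u * x 0 i + u ^+ 2)) / 2.
have S0 : S 0 = sqnorm x / 2 by rewrite /S; congr (_ / _); ring.
have dS : is_derive (0 : R) 1 S (x 0 i).
  by apply: is_derive_eq; rewrite /GRing.scale/=; field.
have dL : is_derive (S 0) 1 (laplace01 f) (- laplace01 (fun t => t * f t) (S 0)).
  exact: is_derive_laplace01.
have d1 := is_derive1_comp dL dS.
have d2 : is_derive (0 : R) 1 (fun u => c * laplace01 f (S u))
    (c * (- laplace01 (fun t => t * f t) (S 0) * x 0 i)).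
  by apply: is_derive_eq; rewrite /GRing.scale/=; ring.
have p0 : 0 < c * laplace01 f (S 0) by rewrite mulr_gt0.
have d3 := @is_derive1_comp _ (@ln R) (fun u => c * laplace01 f (S u)) _ _ _
  (is_derive1_ln p0) d2.
apply: (is_derive_eq d3); rewrite S0.
have n0 := gt_eqF (L0 (sqnorm x / 2)); have cn := gt_eqF c0.
by field; rewrite cn n0.
Qed.

(** The substitution turns the integral of [h] into that of [h((1 - t) / t) t^-2], and [f] is this
    integrand times the positive weight [t^(k / 2)]. *)
Lemma integral_laplace_density_gt0 h : mixing_density h ->
  (0 < \int[mu]_(t in I01) (laplace_density k h t)%:E)%E.
Proof.
move=> [mh h0 Ih].
rewrite ge0_integral_onem_div in Ih; last 2 first.
- exact/measurable_EFinP.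
- by move=> v v0; rewrite lee_fin h0.
have It t : I01 t -> 0 < (1 - t) / t.
  by rewrite /= in_itv/= => /andP[t0 t1]; rewrite divr_gt0// subr_gt0.
have -> : (\int[mu]_(t in I01) (laplace_density k h t)%:E =
  \int[mu]_(t in I01) (t `^ (k%:R / 2) * (h ((1 - t) / t) * t ^- 2))%:E)%E.
  apply: eq_integral => t /set_mem I; rewrite laplace_density01//; congr EFin.
  move: I; rewrite /= in_itv/= => /andP[t0 t1].
  by rewrite powR_sub2//; ring.
have mdiv : measurable_fun I01 (fun t : R => (1 - t) / t).
  apply: measurable_funTS; apply: measurable_funM; first exact: measurable_funB.
  exact: measurable_funV.
apply: integral_weight_gt0 => //.
- apply: measurable_funM.
    apply: (measurable_comp (F := Ipos)) mdiv => //.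
    by move=> _ [t /It t0 <-]; rewrite /= in_itv/= t0.
  by apply: measurable_funTS; apply: measurable_funV; exact: measurable_funX.
- by apply: measurable_funTS; exact: measurable_powR.
- by move=> t I; rewrite mulr_ge0 ?h0 ?It// invr_ge0 sqr_ge0.
- by move=> t; rewrite /= in_itv/= => /andP[t0 _]; exact: powR_gt0.
Qed.

Lemma bayes_estimator_minimax h (G : R -> R) : mixing_density h ->
  is_laplace_transform (laplace_density k h) G -> minimaxity_condition k G ->
  minimax (@bayes_estimator R k h).
Proof.
move=> hmix LG cond.
have [intf GL] := is_laplace_transform01 (@laplace_density_ge1 h) LG.
have If := integral_laplace_density_gt0 hmix.
have -> : @bayes_estimator R k h = fun x =>
    x + - (laplace01 (fun t => t * laplace_density k h t) (sqnorm x / 2) /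
           laplace01 (laplace_density k h) (sqnorm x / 2)) *: x.
  by apply/funext => x; exact: bayes_estimatorE.
apply: (laplace01_minimax intf _ If GL cond) => t It.
have [_ h0 _] := hmix.
rewrite laplace_density01// mulr_ge0 ?powR_ge0// h0//.
by move: It; rewrite /= in_itv/= => /andP[t0 t1]; rewrite divr_gt0// subr_gt0.
Qed.

End bayes.

(** * The functions obtained from a squared primitive *)

Section squared_primitive.
Context {R : realType}.
Notation mu := (@lebesgue_measure R).
Implicit Types (f phi : R -> R) (a s t u r : R) (b x : \bar R).

Lemma open_between_fin r s : open_between r%:E s%:E = [set` `]r, s[].
Proof. by apply/seteqP; split => t; rewrite /open_between/= in_itv/= !lte_fin. Qed.

Lemma open_between_y s : open_between s%:E +oo%E = [set` `]s, +oo[].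
Proof.
by apply/seteqP; split => t; rewrite /open_between/= in_itv/= lte_fin ltry.
Qed.

Lemma open_between0 b x : (x <= b)%E -> open_between b x = set0.
Proof.
move=> xb; apply/seteqP; split => t //= /andP[bt tx].
by have := lt_trans bt (lt_le_trans tx xb); rewrite ltxx.
Qed.

Lemma measurable_open_between b x : measurable (open_between b x).
Proof.
rewrite (_ : open_between b x = EFin @^-1` [set` `]b, x[]).
  rewrite -[X in measurable X]setTI.
  exact: (EFin_measurable measurableT (emeasurable_itv _)).
by apply/seteqP; split => t; rewrite /open_between/= in_itv.
Qed.

Lemma integrable_betweenE_le b x f : (b <= x)%E -> integrable_between b x f ->
  mu.-integrable (open_between b x) (EFin \o f).
Proof. by move=> bx; rewrite /integrable_between (open_between0 bx) setU0. Qed.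

Lemma integrable_betweenE_ge b x f : (x <= b)%E -> integrable_between b x f ->
  mu.-integrable (open_between x b) (EFin \o f).
Proof. by move=> xb; rewrite /integrable_between (open_between0 xb) set0U. Qed.

(** The constant is the oriented integral from [b] to [s]. This reduces differentiation from a base
    point on either side of [s], or infinite, to an ordinary integral over []s, t]]. *)
Lemma oriented_integralE b s u f : (-oo < b)%E ->
  mu.-integrable [set` `[s, u]] (EFin \o f) ->
  integrable_between b s%:E f -> integrable_between b u%:E f ->
  exists C : R, forall t, s < t < u ->
    oriented_integral b t%:E f = C + \int[mu]_(r in [set` `]s, t]]) f r.
Proof.
move=> bNy isu ibs ibu.
have su_oc t : t < u -> mu.-integrable [set` `]s, t]] (EFin \o f).
  move=> tu; apply: integrableS isu => //.
  by apply: subset_itv; rewrite bnd_simp// ltW.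
have su_oo t : t < u -> mu.-integrable [set` `]s, t[] (EFin \o f).
  by move=> tu; apply: integrableS (su_oc _ tu) => //; apply: subset_itvl; rewrite bnd_simp.
case: b bNy ibs ibu => [r _ ibs ibu|_ ibs _|//]; last first.
  exists (- \int[mu]_(v in [set` `]s, +oo[]) f v) => t /andP[st tu].
  have := integrable_betweenE_ge (leey _) ibs; rewrite open_between_y => isy.
  rewrite /oriented_integral (open_between0 (leey _)) Rintegral_set0 open_between_y.
  by rewrite -(@Rintegral_itvB _ _ (BRight s) +oo%O t)// ?bnd_simp ?ltW//; ring.
have [rs|sr] := leP r s.
  exists (\int[mu]_(v in [set` `]r, s]]) f v) => t /andP[st tu].
  have ru : r <= u by rewrite (le_trans rs)// ltW// (lt_trans st).
  have := integrable_betweenE_le _ ibu; rewrite lee_fin => /(_ ru).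
  rewrite open_between_fin => iru.
  have irt : mu.-integrable [set` `]r, t[] (EFin \o f).
    by apply: integrableS iru => //; apply: subset_itvl; rewrite bnd_simp ltW.
  rewrite /oriented_integral (@open_between0 t%:E); last first.
    by rewrite lee_fin (le_trans rs)// ltW.
  rewrite Rintegral_set0 open_between_fin subr0.
  rewrite -(Rintegral_itv_bndo_bndc (su_oo _ tu)).
  by rewrite -(@Rintegral_itvB _ _ (BRight r) (BLeft t) s)// ?bnd_simp//; ring.
have := integrable_betweenE_ge _ ibs; rewrite lee_fin => /(_ (ltW sr)).
rewrite open_between_fin => isr.
exists (- \int[mu]_(v in [set` `]s, r[]) f v) => t /andP[st tu].
rewrite /oriented_integral !open_between_fin.
have [tr|rt] := leP t r.
  rewrite [X in X - _](_ : _ = 0); last first.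
    by rewrite set_itv_ge ?Rintegral_set0// bnd_simp -leNgt.
  have [->|tr'] := eqVneq t r.
    rewrite set_itvoo0 ?Rintegral_set0// -(Rintegral_itv_bndo_bndc isr).
    by rewrite subrr addNr.
  by rewrite -(@Rintegral_itvB _ _ (BRight s) (BLeft r) t)// ?bnd_simp ?ltW//
    ?lt_neqAle ?tr'//; ring.
rewrite [X in _ - X](_ : _ = 0); last first.
  by rewrite set_itv_ge ?Rintegral_set0// bnd_simp -leNgt ltW.
rewrite -(Rintegral_itv_bndo_bndc (su_oo _ tu)) (Rintegral_itv_bndo_bndc isr).
by rewrite -(@Rintegral_itvB _ _ (BRight s) (BLeft t) r)// ?bnd_simp ?ltW//;
  [ring|exact: su_oo].
Qed.

Lemma is_derive_oriented_integral b s t u f : (-oo < b)%E -> s < t < u ->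
  mu.-integrable [set` `[s, u]] (EFin \o f) ->
  integrable_between b s%:E f -> integrable_between b u%:E f ->
  {for t, continuous f} ->
  is_derive t 1 (fun r => oriented_integral b r%:E f) (f t).
Proof.
move=> bNy /andP[st tu] isu ibs ibu cf.
have [C CE] := oriented_integralE bNy isu ibs ibu.
have isu' : mu.-integrable [set` `]s, u]] (EFin \o f).
  by apply: integrableS isu => //; apply: subset_itvr; rewrite bnd_simp.
have [dF dFE] := @continuous_FTC1 _ f (BRight s) t u tu isu' st cf.
have d1 : is_derive t 1 (fun r => C + \int[mu]_(v in [set` `]s, r]]) f v) (f t).
  have dI : is_derive t 1 (fun r => \int[mu]_(v in [set` `]s, r]]) f v) (f t).
    by apply: DeriveDef; [exact: dF|rewrite -derive1E; exact: dFE].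
  by have := is_deriveD (is_derive_cst C t 1) dI; rewrite add0r.
apply: near_eq_is_derive d1.
have : t \in `]s, u[ by rewrite in_itv/= st.
move=> /near_in_itvoo; apply: filterS => r; rewrite in_itv/= => rsu.
by rewrite CE.
Qed.

Lemma continuous_itvcc_integrable f s u : 0 < s ->
  (forall t, 0 < t -> {for t, continuous f}) ->
  mu.-integrable [set` `[s, u]] (EFin \o f).
Proof.
move=> s0 cf; apply: continuous_compact_integrable; first exact: segment_compact.
apply: continuous_in_subspaceT => t /set_mem/=; rewrite in_itv/= => /andP[st _].
by apply: cf; exact: lt_le_trans st.
Qed.

Lemma open_between_nonnull b s : (-oo < b)%E -> s%:E <> b ->
  (0 < mu (open_between b s%:E `|` open_between s%:E b))%E.
Proof.
case: b => [r _ sr|_ _|//]; last first.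
  rewrite (open_between0 (leey _)) set0U open_between_y lebesgue_measure_itv/= ltry.
  by rewrite addye// ltry.
have [rs|sr'] := leP r s.
  rewrite setUC (@open_between0 s%:E) ?lee_fin// set0U open_between_fin.
  have rs' : r < s by rewrite lt_neqAle rs andbT; apply/eqP => rs'; apply: sr; rewrite rs'.
  by rewrite lebesgue_measure_itv/= lte_fin rs' -EFinB lte_fin subr_gt0.
rewrite (@open_between0 r%:E) ?lee_fin ?ltW// set0U open_between_fin.
by rewrite lebesgue_measure_itv/= lte_fin sr' -EFinB lte_fin subr_gt0.
Qed.

(** Exactly one of the two intervals in the oriented integral is nonempty; it has positive length,
    so a positive integrand gives a nonzero value, whatever its sign. *)
Lemma oriented_integral_neq0 b s f : (-oo < b)%E -> s%:E <> b ->
  (forall t, 0 < f t) -> integrable_between b s%:E f ->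
  oriented_integral b s%:E f <> 0.
Proof.
move=> bNy sb f0 ib.
have pos (D : set R) : measurable D -> (0 < mu D)%E ->
    mu.-integrable D (EFin \o f) -> 0 < \int[mu]_(t in D) f t.
  move=> mD D0 iD; rewrite /Rintegral fine_gt0// ltey_eq integrable_fin_num// andbT.
  have mf : measurable_fun D f by apply/measurable_EFinP; exact: measurable_int iD.
  have -> : (\int[mu]_(t in D) (f t)%:E = \int[mu]_(t in D) (f t * (fun=> 1) t)%:E)%E.
    by apply: eq_integral => t _; rewrite /= mulr1.
  apply: integral_weight_gt0 => //.
  by rewrite (eq_integral (cst 1%E))// integral_cst// mul1e.
have := open_between_nonnull bNy sb.
have [bs|sb'] := leP b s%:E.
  rewrite setUC (open_between0 bs) set0U /oriented_integral (open_between0 bs).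
  rewrite Rintegral_set0 subr0 => D0; apply/eqP; rewrite gt_eqF// pos//.
    exact: measurable_open_between.
  exact: integrable_betweenE_le.
rewrite (open_between0 (ltW sb')) set0U /oriented_integral (open_between0 (ltW sb')).
rewrite Rintegral_set0 sub0r => D0; apply/eqP; rewrite oppr_eq0 gt_eqF// pos//.
  exact: measurable_open_between.
by apply: integrable_betweenE_ge => //; exact: ltW.
Qed.

Section properties.
Variables (k : nat) (phi : R -> R) (a : R) (b : \bar R).
Hypothesis phi_cont : {in `]0, +oo[, continuous phi}.
Hypothesis phi_le : forall s, 0 < s -> phi s <= k%:R / s.
Hypothesis bNy : (-oo < b)%E.
Hypothesis def : squared_primitive_defined phi a b.

Let phi_c t : 0 < t -> {for t, continuous phi}.
Proof. by move=> t0; apply: phi_cont; rewrite in_itv/= t0. Qed.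

Let E := inner_exp phi a.
Let U t := oriented_integral b t%:E E.

(** The assumption speaks only of points strictly between [b] and some [s > 0]. A point [r] other
    than [b] is put there by [s = r + 1] or [s = r / 2], on the side away from [b]; for [t = b] the
    interval is first prolonged beyond [t], away from [a]. *)
Lemma integrable_between_inner t : 0 < t -> integrable_between a%:E t%:E phi.
Proof.
have ne r : 0 < r -> r%:E != b -> integrable_between a%:E r%:E phi.
  move=> r0 rb; have r20 : 0 < r / 2 by rewrite divr_gt0.
  have r1 : 0 < r + 1 by rewrite addr_gt0.
  have [br|br] := ltP b r%:E.
    have [h _] := def r1; apply: h; left.
    by apply/andP; split=> //; rewrite lte_fin ltrDl ltr01.
  have [h _] := def r20; apply: h; right.
  apply/andP; split; last by rewrite lt_neqAle rb.
  by rewrite lte_fin ltr_pdivrMr// mulr_natr mulr2n ltrDl.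
move=> t0; have [tb|] := eqVneq t%:E b; last exact: ne.
have [at_|ta] := leP a t.
  have h : integrable_between a%:E (t + 1)%:E phi.
    by apply: ne; rewrite ?addr_gt0// -tb eqe gt_eqF// ltrDl.
  apply: integrableS h.
  - by apply: measurableU; exact: measurable_open_between.
  - by apply: measurableU; exact: measurable_open_between.
  - rewrite (@open_between0 t%:E) ?lee_fin// setU0 => r /=.
    rewrite /open_between/= => /andP[ar rt]; left => /=.
    by rewrite ar (lt_trans rt)// lte_fin ltrDl.
have t2 : t / 2 < t by rewrite ltr_pdivrMr// mulr_natr mulr2n ltrDl.
have h : integrable_between a%:E (t / 2)%:E phi.
  by apply: ne; rewrite ?divr_gt0// -tb eqe lt_eqF.
apply: integrableS h.
- by apply: measurableU; exact: measurable_open_between.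
- by apply: measurableU; exact: measurable_open_between.
- rewrite (@open_between0 a%:E) ?lee_fin ?ltW// set0U => r /=.
  rewrite /open_between/= => /andP[ar rt]; right => /=.
  by rewrite rt andbT (lt_trans _ ar)// lte_fin.
Qed.

Lemma is_derive_inner_exp t : 0 < t -> is_derive t 1 E (- (1 / 2) * phi t * E t).
Proof.
move=> t0.
have t20 : 0 < t / 2 by rewrite divr_gt0.
have t1 : 0 < t + 1 by rewrite addr_gt0.
have d1 : is_derive t 1 (fun r => oriented_integral a%:E r%:E phi) (phi t).
  apply: (@is_derive_oriented_integral _ (t / 2) _ (t + 1)) => //.
  - exact: ltNyr.
  - by rewrite ltr_pdivrMr// mulr_natr mulr2n !ltrDl t0 ltr01.
  - exact: continuous_itvcc_integrable.
  - exact: integrable_between_inner.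
  - exact: integrable_between_inner.
  - exact: phi_c.
have d2 : is_derive t 1 (fun r => - (1 / 2) * oriented_integral a%:E r%:E phi)
    (- (1 / 2) * phi t).
  by apply: is_derive_eq; rewrite /GRing.scale/=; ring.
have d3 := @is_derive1_comp _ expR
  (fun r => - (1 / 2) * oriented_integral a%:E r%:E phi) _ _ _ (is_derive_expR _) d2.
by apply: (is_derive_eq d3); rewrite /E /inner_exp mulrC.
Qed.

Let E_gt0 t : 0 < E t. Proof. exact: expR_gt0. Qed.

Let dU t : 0 < t -> is_derive t 1 U (E t).
Proof.
move=> t0.
have t20 : 0 < t / 2 by rewrite divr_gt0.
have t1 : 0 < t + 1 by rewrite addr_gt0.
have cE r : 0 < r -> {for r, continuous E}.
  by move=> r0; exact: is_derive_continuous (is_derive_inner_exp r0).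
apply: (@is_derive_oriented_integral _ (t / 2) _ (t + 1)) => //.
- by rewrite ltr_pdivrMr// mulr_natr mulr2n !ltrDl t0 ltr01.
- exact: continuous_itvcc_integrable.
- by have [] := def t20.
- by have [] := def t1.
- exact: cE.
Qed.

Let G := squared_primitive phi a b.

Let dG t : 0 < t -> is_derive t 1 G (2 * (U t * E t)).
Proof.
move=> t0; have := dU t0 => ?.
have -> : G = fun t => U t ^+ 2 by [].
by apply: is_derive_eq; rewrite /GRing.scale/=; ring.
Qed.

Let dG1 t : 0 < t -> is_derive t 1 G^`()%classic
  (2 * (E t ^+ 2 + U t * (- (1 / 2) * phi t * E t))).
Proof.
move=> t0; have := dU t0 => ?; have := is_derive_inner_exp t0 => ?.
have d : is_derive t 1 (fun r => 2 * (U r * E r))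
    (2 * (E t ^+ 2 + U t * (- (1 / 2) * phi t * E t))).
  by apply: is_derive_eq; rewrite /GRing.scale/=; ring.
apply: near_eq_is_derive d; apply: (near_gt0 t0) => r r0.
by rewrite derive1E; have [_ ->] := dG r0.
Qed.

Let G1E t : 0 < t -> G^`()%classic t = 2 * (U t * E t).
Proof. by move=> t0; rewrite derive1E; have [_ ->] := dG t0. Qed.

Let U_neq0 t : 0 < t -> t%:E <> b -> U t <> 0.
Proof.
move=> t0 tb; apply: oriented_integral_neq0 => //.
by have [] := def t0.
Qed.

(** Derivatives and quotients are total functions; this certifies that those of the minimaxity
    condition are genuine away from [b]. *)
Lemma squared_primitive_derivable s : 0 < s ->
  [/\ derivable G s 1, derivable G^`()%classic s 1 &
      s%:E <> b -> G s <> 0 /\ G^`()%classic s <> 0].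
Proof.
move=> s0; split; [by have [] := dG s0|by have [] := dG1 s0|].
move=> sb; have /eqP Us := U_neq0 s0 sb.
split; apply/eqP.
  by rewrite -[G s]/(U s ^+ 2) expf_neq0.
by rewrite G1E// mulf_neq0// mulf_neq0// gt_eqF.
Qed.

Lemma squared_primitive_minimaxity_condition : minimaxity_condition k G.
Proof.
move=> s s0.
have e : \forall r \near s, G^`(1)%classic r = G^`()%classic r.
  by apply: (near_gt0 s0) => r _; rewrite derive1n1.
have G2E : G^`(2)%classic s = 2 * (E s ^+ 2 + U s * (- (1 / 2) * phi s * E s)).
  rewrite derive1nS derive1E.
  transitivity ('D_1 G^`()%classic s); first exact: near_eq_derive e.
  by have [_] := dG1 s0.
rewrite G2E G1E// -[G s]/(U s ^+ 2).
(* When [U s = 0], which forces [s = b], both quotients are zero by convention and [0 <= k / s]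
   remains. *)
have [->|U0] := eqVneq (U s) 0.
  by rewrite mul0r mulr0 mul0r invr0 !mulr0 subr0 divr_ge0// ltW.
apply: le_trans (phi_le s0); rewrite le_eqVlt; apply/orP; left; apply/eqP.
by field; rewrite U0 gt_eqF.
Qed.

End properties.
End squared_primitive.

(** * Injectivity of the Laplace transform *)

Section laplace_uniqueness.
Context {R : realType}.
Notation mu := (@lebesgue_measure R).
Notation I01 := (`]0%R, 1%R[%classic : set R).
Implicit Types (d f : R -> R) (s t q T : R).

Let mI01 : measurable I01. Proof. exact: measurable_itv. Qed.

(** Negative [q] is allowed: the inequality is applied to both [1 - q] and [1 + q] in the step
    approximations. *)
Lemma bernoulli_le q n : 0 <= 1 + q -> 1 + n%:R * q <= (1 + q) ^+ n.
Proof.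
move=> q1; elim: n => [|n IH]; first by rewrite mul0r addr0 expr0.
rewrite exprS; apply: le_trans (ler_wpM2l q1 IH).
rewrite -natr1 -subr_ge0.
have -> : (1 + q) * (1 + n%:R * q) - (1 + (n%:R + 1) * q) = n%:R * q ^+ 2 by ring.
by rewrite mulr_ge0// sqr_ge0.
Qed.

(* With [q = exp (- n t)] and [N = floor (exp (n T))], [(1 - q)^N] tends to the
   indicator of [t > T]. *)
Lemma step_approx_gt T t n : T < t -> 0 <= t ->
  1 - expR (T - t) ^+ n <=
  (1 - expR (- (n%:R * t))) ^+ Num.truncn (expR (n%:R * T)) <= 1.
Proof.
move=> Tt t0.
set q := expR (- (n%:R * t)); set N := Num.truncn _.
have q0 : 0 <= q by exact: expR_ge0.
have q1 : q <= 1 by rewrite expR_le1 oppr_le0 mulr_ge0.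
apply/andP; split; last by rewrite exprn_ile1 ?subr_ge0// lerBlDr lerDl.
(* Bernoulli's inequality gives [1 - N q], and [N q <= exp(n (T - t))]. *)
have := @bernoulli_le (- q) N; rewrite subr_ge0 => /(_ q1); apply: le_trans.
rewrite mulrN lerD2l lerN2 -expRM_natl mulrBr expRD -/q ler_wpM2r//.
by rewrite truncn_le// expR_ge0.
Qed.

(** The product [(1 - q)^N (1 + q)^N = (1 - q^2)^N] is at most one, and [(1 + q)^N >= 1 + N q >= (N
    + 1) q >= exp(n (T - t))]. *)
Lemma step_approx_lt T t n : t < T -> 0 <= t ->
  0 <= (1 - expR (- (n%:R * t))) ^+ Num.truncn (expR (n%:R * T)) <=
  expR (t - T) ^+ n.
Proof.
move=> tT t0.
set q := expR (- (n%:R * t)); set N := Num.truncn _.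
have q0 : 0 <= q by exact: expR_ge0.
have q1 : q <= 1 by rewrite expR_le1 oppr_le0 mulr_ge0.
apply/andP; split; first by rewrite exprn_ge0 ?subr_ge0.
have e0 : 0 < expR (n%:R * (T - t)) by exact: expR_gt0.
have -> : expR (t - T) ^+ n = (expR (n%:R * (T - t)))^-1.
  by rewrite -expRM_natl -expRN -mulrN opprB.
rewrite -div1r ler_pdivlMr//.
apply: (@le_trans _ _ ((1 - q) ^+ N * (1 + q) ^+ N)); last first.
  rewrite -exprMn exprn_ile1//; first by rewrite mulr_ge0 ?subr_ge0// addr_ge0.
  by have := sqr_ge0 q; nra.
rewrite ler_wpM2l ?exprn_ge0 ?subr_ge0//.
apply: le_trans (bernoulli_le _ _); last by rewrite addr_ge0.
have : expR (n%:R * T) <= N%:R + 1 by rewrite natr1 ltW// truncnS_gt.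
move=> h; have := ler_wpM2r q0 h.
rewrite /q -expRD -mulrBr -/q mulrDl mul1r => /le_trans; apply.
by rewrite addrC lerD2r.
Qed.

Lemma step_norm_le1 (n N : nat) t : 0 <= t ->
  `|(1 - expR (- (n%:R * t))) ^+ N| <= 1.
Proof.
move=> t0; have q0 := expR_ge0 (- (n%:R * t)).
have q1 : expR (- (n%:R * t)) <= 1 by rewrite expR_le1 oppr_le0 mulr_ge0.
by rewrite normrX exprn_ile1// ger0_norm ?subr_ge0// lerBlDr lerDl.
Qed.

Let measurable_step (n N : nat) :
  measurable_fun I01 (fun t : R => (1 - expR (- (n%:R * t))) ^+ N).
Proof.
apply: measurable_funX; apply: measurable_funB => //.
have := @measurable_expRM _ n%:R I01.
rewrite (_ : (fun t => expR (- n%:R * t)) = (fun t => expR (- (n%:R * t))))//.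
by apply/funext => t; rewrite mulNr.
Qed.

(** One more factor [1 - exp(- n t)] replaces the integral at [s] by its difference with the one at
    [s + n]; hence the induction on [N] for all [s > 0] at once. *)
Lemma laplace01_step_eq0 d (n N : nat) s : mu.-integrable I01 (EFin \o d) ->
  (forall r, 0 < r -> laplace01 d r = 0) -> 0 < s ->
  \int[mu]_(t in I01)
    ((1 - expR (- (n%:R * t))) ^+ N * (expR (- s * t) * d t)) = 0.
Proof.
move=> intd d0; elim: N s => [|N IH] s s0.
  by under eq_Rintegral do rewrite expr0 mul1r; exact: d0.
have int_s r : mu.-integrable I01 (EFin \o (fun t =>
    (1 - expR (- (n%:R * t))) ^+ N * (expR (- r * t) * d t))).
  apply: (@integrable_bounded_mul _ _ _ 1).
  - exact: measurable_step.
  - by move=> t; rewrite /= in_itv/= => /andP[/ltW t0 _]; exact: step_norm_le1.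
  - exact: integrable_laplace01.
have sn : 0 < s + n%:R by rewrite ltr_wpDr.
pose A r := \int[mu]_(t in I01)
  ((1 - expR (- (n%:R * t))) ^+ N * (expR (- r * t) * d t)).
transitivity (A s - A (s + n%:R)); last by rewrite /A !IH ?subr0.
rewrite /A -RintegralB//; apply: eq_Rintegral => t _.
by rewrite exprSr opprD mulrDl expRD (mulNr n%:R); ring.
Qed.

(** The step functions converge to the indicator of [t > T], and against each of them the integral
    is zero. The factor [exp(- t)] keeps every transform involved at a positive argument. *)
Lemma integral_tail_eq0 d T : mu.-integrable I01 (EFin \o d) ->
  (forall r, 0 < r -> laplace01 d r = 0) ->
  (\int[mu]_(t in I01 `&` [set t : R | (T < t)%R]) (expR (- 1 * t) * d t)%:E = 0)%E.
Proof.
move=> intd d0.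
pose g t := expR (- 1 * t) * d t.
have intg : mu.-integrable I01 (EFin \o g) by exact: integrable_laplace01.
have mg : measurable_fun I01 g by apply/measurable_EFinP; exact: measurable_int intg.
have mT : measurable [set t : R | T < t].
  rewrite (_ : mkset _ = `]T, +oo[%classic); first exact: measurable_itv.
  by apply/seteqP; split => t /=; rewrite in_itv/= andbT.
pose w (n : nat) t := (1 - expR (- (n%:R * t))) ^+ Num.truncn (expR (n%:R * T)).
pose f_ (n : nat) t := (w n t * g t)%:E.
pose h t := (\1_[set t : R | T < t] t * g t)%:E.
have mw n : measurable_fun I01 (w n) by exact: measurable_step.
have mf_ n : measurable_fun I01 (f_ n).
  by apply/measurable_EFinP; exact: measurable_funM.
have mh : measurable_fun I01 h.
  by apply/measurable_EFinP; apply: measurable_funM => //; exact: measurable_indic.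
have I0 t : I01 t -> 0 <= t by rewrite /= in_itv/= => /andP[/ltW].
have f_h : {ae mu, forall t, I01 t -> f_ ^~ t @ \oo --> h t}.
  (* The pointwise limit is claimed only off [t = T], a null set. *)
  exists [set T]; split; [exact: measurable_set1|exact: lebesgue_measure_set1|].
  move=> t /=; apply: contra_notP => /eqP tT It; apply: cvg_EFin; first exact: nearW.
  apply: cvgM; last exact: cvg_cst.
  have [Tt|tT'] := ltP T t.
    rewrite indicE mem_set//.
    have lim1 : 1 - expR (T - t) ^+ n @[n --> \oo] --> (1 : R).
      rewrite -[X in _ --> X]subr0; apply: cvgB; first exact: cvg_cst.
      by apply: cvg_expr; rewrite ger0_norm ?expR_ge0// expR_lt1 subr_lt0.
    apply: (@squeeze_cvgr _ _ _ _ _ (cst 1)) lim1 (cvg_cst _).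
    by apply: nearW => n; apply: step_approx_gt => //; exact: I0.
  have {}tT : t < T by rewrite lt_neqAle tT.
  rewrite indicE memNset; last by move=> /=; apply/negP; rewrite -leNgt ltW.
  have lim0 : expR (t - T) ^+ n @[n --> \oo] --> (0 : R).
    by apply: cvg_expr; rewrite ger0_norm ?expR_ge0// expR_lt1 subr_lt0.
  apply: (@squeeze_cvgr _ _ _ _ (cst 0)) (cvg_cst _) lim0.
  by apply: nearW => n; apply: step_approx_lt => //; exact: I0.
have f_ub : {ae mu, forall t n, I01 t -> (`|f_ n t| <= (abse \o (EFin \o g)) t)%E}.
  apply: aeW => t n It /=; rewrite lee_fin normrM ler_piMl//.
  by apply: step_norm_le1; exact: I0.
have [_ _ H] := @dominated_convergence _ _ _ mu I01 mI01 f_ h _ mf_ mh f_h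
  (integrable_abse intg) f_ub.
have f_0 : [sequence (\int[mu]_(t in I01) f_ n t)%E]_n = cst 0%E.
  apply/funext => n.
  have : (\int[mu]_(t in I01) f_ n t)%E \is a fin_num.
    apply: integrable_fin_num => //.
    apply: (@integrable_bounded_mul _ _ _ 1) => // t It.
    by apply: step_norm_le1; exact: I0.
  move=> fin; transitivity ((fine (\int[mu]_(t in I01) f_ n t)%E)%:E).
    exact/esym/fineK.
  by congr EFin; exact: laplace01_step_eq0.
rewrite f_0 in H.
transitivity (\int[mu]_(t in I01) h t)%E.
  rewrite integral_mkcondr; apply: eq_integral => t _.
  by rewrite patchE /h indicE; case: ifPn => _; rewrite ?mul1r ?mul0r.
exact: (cvg_unique _ H (cvg_cst _)).
Qed.

(** All tails of [exp(- t) d] vanish, hence so does its primitive from [-oo]; by Lebesgue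
    differentiation the function is zero almost everywhere. *)
Lemma laplace01_eq0_ae d : mu.-integrable I01 (EFin \o d) ->
  (forall r, 0 < r -> laplace01 d r = 0) ->
  {ae mu, forall t, I01 t -> d t = 0}.
Proof.
move=> intd d0.
pose g t := expR (- 1 * t) * d t.
have intg : mu.-integrable I01 (EFin \o g) by exact: integrable_laplace01.
pose G := g \_ I01.
have intG : mu.-integrable setT (EFin \o G).
  by rewrite /G -restrict_EFin; apply/integrable_restrict => //; rewrite setTI.
have tail0 x : \int[mu]_(t in [set` `]x, +oo[]) G t = 0.
  rewrite /Rintegral -[RHS]/(fine 0%E) -(@integral_tail_eq0 d x intd d0); congr fine.
  rewrite integral_mkcond [RHS]integral_mkcond; apply: eq_integral => t _.
  rewrite !patchE /G in_setI patchE.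
  have -> : (t \in [set` `]x, +oo[]) = (t \in [set t | x < t]).
    by apply/idP/idP => /set_mem/= h; apply/mem_set; move: h; rewrite /= in_itv/= andbT.
  by case: (t \in I01); case: (t \in _).
have head0 x : \int[mu]_(t in [set` `]-oo, x]]) G t = 0.
  have := @Rintegral_itvB _ G -oo%O +oo%O x; rewrite set_itvNyy => /(_ intG).
  rewrite tail0 !bnd_simp => /(_ isT isT) /eqP; rewrite subr_eq0 => /eqP <-.
  (* The integrand vanishes outside []0, 1[], so the tail from [-1] is the whole integral. *)
  have <- := tail0 (- 1).
  rewrite Rintegral_mkcond [RHS]Rintegral_mkcond; apply: eq_Rintegral => t _.
  rewrite !patchE in_setT; case: ifPn => //; rewrite notin_setE/= in_itv/= andbT => t1.
  rewrite /G patchE memNset//= in_itv/= => /andP[t0 _].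
  by apply: t1; apply: lt_trans t0; rewrite ltrN10.
have locG : locally_integrable setT G by apply: open_integrable_locally => //; exact: openT.
have intGy y : mu.-integrable [set` `]-oo, y]] (EFin \o G).
  exact: integrableS intG.
have := FTC1Ny intGy locG.
apply: filterS; first exact: (ae_filter_ringOfSetsType mu).
move=> t /= [_]; rewrite (_ : (fun x => _) = cst 0); last exact/funext.
rewrite derive1_cst => Gt It.
move: Gt; rewrite /G patchE mem_set// /g => /esym/eqP.
by rewrite mulf_eq0 gt_eqF ?expR_gt0//= => /eqP.
Qed.

Lemma laplace01_inj f1 f2 : mu.-integrable I01 (EFin \o f1) ->
  mu.-integrable I01 (EFin \o f2) ->
  (forall s, 0 < s -> laplace01 f1 s = laplace01 f2 s) ->
  {ae mu, forall t, I01 t -> f1 t = f2 t}.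
Proof.
move=> int1 int2 f12.
have intd : mu.-integrable I01 (EFin \o (f1 \- f2)).
  exact: (@integrableB _ _ _ mu I01 mI01 _ _ int1 int2).
have : forall r, 0 < r -> laplace01 (f1 \- f2) r = 0.
  move=> r r0; apply/eqP; rewrite -(subrr (laplace01 f1 r)) {2}f12// /laplace01.
  rewrite -RintegralB//; last 2 first.
  - exact: integrable_laplace01.
  - exact: integrable_laplace01.
  by apply/eqP; apply: eq_Rintegral => t _; rewrite /= mulrBr.
move=> /(laplace01_eq0_ae intd); apply: filterS.
  exact: (ae_filter_ringOfSetsType mu).
move=> t h It.
by apply/eqP; rewrite -subr_eq0; apply/eqP; exact: h.
Qed.

End laplace_uniqueness.

(** * Mixing densities *)

Section mixing_density.
Context {R : realType} {k : nat}.
Notation mu := (@lebesgue_measure R).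
Notation I01 := (`]0%R, 1%R[%classic : set R).
Notation Ipos := (`]0%R, +oo[%classic : set R).
Implicit Types (f h : R -> R) (t : R).

Lemma laplace_density_mixing f t : I01 t ->
  laplace_density k (mixing_of_laplace_density k f) t = f t.
Proof.
move=> It; rewrite laplace_density01// /mixing_of_laplace_density.
move: It; rewrite /= in_itv/= => /andP[t0 t1].
have tn : t != 0 by rewrite gt_eqF.
have -> : (1 - t) / t + 1 = t^-1 by field.
rewrite mulrA -powRM ?invr_ge0 ?(ltW t0)// divff// powR1 ?mul1r.
by rewrite invrK.
Qed.

Lemma is_laplace_transform_mixing f (G : R -> R) : (forall t, 1 <= t -> f t = 0) ->
  is_laplace_transform f G ->
  is_laplace_transform (laplace_density k (mixing_of_laplace_density k f)) G.
Proof.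
move=> f1 LG s s0; have [intf <-] := LG s s0.
have E t : Ipos t -> laplace_density k (mixing_of_laplace_density k f) t = f t.
  rewrite /= in_itv/= andbT => t0; have [t1|t1] := leP 1 t.
    by rewrite laplace_density_ge1// f1.
  by apply: laplace_density_mixing; rewrite /= in_itv/= t0.
split; last by apply: eq_Rintegral => t /set_mem /E ->.
by apply: eq_integrable intf => // t /set_mem Et /=; rewrite E.
Qed.

Lemma mixing_density_of_laplace f : measurable_fun I01 f ->
  (forall t, I01 t -> 0 <= f t) -> (0 < \int[mu]_(t in I01) (f t)%:E)%E ->
  mixing_density (mixing_of_laplace_density k f).
Proof.
move=> mf f0 If.
have I1p v : Ipos v -> I01 (1 / (v + 1)).
  rewrite /= !in_itv/= andbT => v0; rewrite div1r invr_gt0 addr_gt0//=.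
  by rewrite invf_lt1 ?addr_gt0// ltrDr.
have m1p : measurable_fun Ipos (fun v : R => v + 1) by exact: measurable_funD.
have mh : measurable_fun Ipos (mixing_of_laplace_density k f).
  apply: measurable_funM; first exact: (measurableT_comp (measurable_powR _)).
  apply: (measurable_comp (F := I01)) mf _ => //.
    by move=> _ [v /I1p v1 <-].
  apply: measurable_funM => //; apply: measurable_funTS.
  by apply: measurable_funV; exact: measurable_funD.
have h0 v : 0 < v -> 0 <= mixing_of_laplace_density k f v.
  move=> v0; rewrite mulr_ge0 ?powR_ge0//; apply/f0/I1p.
  by rewrite /= in_itv/= v0.
split=> //.
rewrite ge0_integral_onem_div; last 2 first.
- exact/measurable_EFinP.
- by move=> v v0; rewrite lee_fin h0.
pose w (t : R) := t^-1 `^ (k%:R / 2 - 2) * t ^- 2.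
have -> : (\int[mu]_(t in I01)
   ((mixing_of_laplace_density k f ((1 - t) / t))%:E * (t ^- 2)%:E) =
   \int[mu]_(t in I01) (w t * f t)%:E)%E.
  apply: eq_integral => t /set_mem; rewrite /= in_itv/= => /andP[t0 t1].
  rewrite -EFinM; congr EFin; rewrite /mixing_of_laplace_density /w.
  have -> : (1 - t) / t + 1 = t^-1 by field; rewrite gt_eqF.
  by rewrite div1r invrK; ring.
apply: integral_weight_gt0 => //.
  apply: measurable_funTS; apply: measurable_funM.
    by apply: (measurableT_comp (measurable_powR _)); exact: measurable_funV.
  by apply: measurable_funV; exact: measurable_funX.
move=> t; rewrite /= in_itv/= => /andP[t0 _].
by rewrite mulr_gt0// ?powR_gt0 ?invr_gt0// exprn_gt0.
Qed.

(** The null set is carried from [t] to [v] by applying the change of variables to the integral of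
    [|h' - h|]. *)
Lemma mixing_density_ae_unique h h' : measurable_fun Ipos h -> measurable_fun Ipos h' ->
  {ae mu, forall t, I01 t -> laplace_density k h' t = laplace_density k h t} ->
  {ae mu, forall v, 0 < v -> h' v = h v}.
Proof.
move=> mh mh' ae.
pose H v := `|(h' v - h v)%:E|%E.
have mH : measurable_fun Ipos H.
  by apply: measurableT_comp => //; apply/measurable_EFinP; exact: measurable_funB.
have H0 v : (0 <= H v)%E by exact: abse_ge0.
have mdiv : measurable_fun I01 (fun t : R => (1 - t) / t).
  apply: measurable_funTS; apply: measurable_funM; first exact: measurable_funB.
  exact: measurable_funV.
have It t : I01 t -> Ipos ((1 - t) / t).
  by rewrite /= !in_itv/= andbT => /andP[t0 t1]; rewrite divr_gt0// subr_gt0.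
have IH : (\int[mu]_(v in Ipos) H v = 0)%E.
  rewrite ge0_integral_onem_div//.
  transitivity (\int[mu]_(t in I01) (cst 0 t))%E; last exact: integral0.
  apply: ae_eq_integral => //.
    apply: emeasurable_funM.
      by apply: (measurable_comp (F := Ipos)) mH mdiv => // _ [t /It t0 <-].
    apply/measurable_EFinP; apply: measurable_funTS.
    by apply: measurable_funV; exact: measurable_funX.
  apply: filterS ae; first exact: (ae_filter_ringOfSetsType mu).
  move=> t /= ht I; have := ht I; rewrite !laplace_density01//.
  have t0 : 0 < t by move: I; rewrite /= in_itv/= => /andP[].
  have pn : t `^ (k%:R / 2 - 2) != 0 by rewrite gt_eqF// powR_gt0.
  move=> /(mulfI pn) hh.
  by rewrite /H hh subrr abse0 mul0e.
have mD : measurable_fun Ipos (fun v => (h' v - h v)%:E).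
  by apply/measurable_EFinP; exact: measurable_funB.
have mIpos : measurable Ipos by exact: measurable_itv.
have aeD := (ae_eq_integral_abs mu mIpos mD).1 IH.
apply: filterS aeD => v /= hv v0; have : Ipos v by rewrite /= in_itv/= v0.
by move=> /hv [] /eqP; rewrite subr_eq0 => /eqP.
Qed.

(** By Tonelli's theorem, since each normal density has mass one. Properness of the prior is thus
    positivity and finiteness of the integral of [h]. *)
Lemma integral_mixture_prior h : measurable_fun Ipos h ->
  (forall v, 0 < v -> 0 <= h v) ->
  (\int[lebesgue_rV k]_theta mixture_prior h theta =
   \int[mu]_(v in Ipos) (h v)%:E)%E.
Proof.
move=> mh h0.
pose h' := h \_ Ipos.
have mh' : measurable_fun setT h' by apply/(measurable_restrictT _ _).1.
have h'0 v : 0 <= h' v.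
  by rewrite /h' patchE; case: ifPn => // /set_mem/=; rewrite in_itv/= andbT => /h0.
pose F (z : 'rV[R]_k * R) : \bar R := (normal_density 0 z.2 z.1 * h' z.2)%:E.
have mF : measurable_fun setT F.
  apply/measurable_EFinP; apply: measurable_funM; first exact: measurable_normal_density.
  by apply: measurableT_comp => //; exact: measurable_snd.
have F0 z : (0 <= F z)%E.
  by rewrite /F lee_fin; apply: mulr_ge0 => //; exact: normal_density_ge0.
transitivity (\int[lebesgue_rV k]_theta \int[mu]_v F (theta, v))%E.
  apply: eq_integral => theta _; rewrite /mixture_prior integral_mkcond.
  apply: eq_integral => v _; rewrite /F/= /h' !patchE.
  by case: ifPn => _; rewrite ?mulr0.
rewrite fubini_tonelli// [RHS]integral_mkcond; apply: eq_integral => v _.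
rewrite patchE; case: ifPn => [v0|v0]; last first.
  by apply: integral0_eq => theta _; rewrite /F/= /h' patchE (negbTE v0) mulr0.
have hE : h' v = h v by rewrite /h' patchE v0.
have {}v0 : 0 < v by move: v0; rewrite inE/= in_itv/= andbT.
rewrite -[RHS]mul1e -(@integral_normal_density _ k 0 _ v0) -ge0_integralZr//.
- by apply: eq_integral => theta _; rewrite /F/= hE EFinM.
- by apply/measurable_EFinP; exact: measurable_normal_density.
- by move=> theta _; rewrite lee_fin; exact: normal_density_ge0.
- by rewrite lee_fin h0.
Qed.

(** It serves to show that [f] is not negligible: were its integral zero, its transform would vanish
    identically. *)
Lemma laplace01_le_integral f s : mu.-integrable I01 (EFin \o f) ->
  (forall t, I01 t -> 0 <= f t) ->
  laplace01 f s <= expR `|s| * \int[mu]_(t in I01) f t.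
Proof.
move=> intf f0; have mI : measurable I01 by exact: measurable_itv.
rewrite -RintegralZl//; apply: le_Rintegral => //.
- exact: integrable_laplace01.
- apply: (@integrable_bounded_mul _ _ (cst (expR `|s|)) (expR `|s|)) => //.
  by move=> t _; rewrite ger0_norm ?expR_ge0.
- by move=> t It; rewrite ler_wpM2r ?f0// expR_bound01.
Qed.

End mixing_density.

Theorem corollary4p1 (R : realType) (k : nat) (k_gt0 : (0 < k)%N) :
  (forall h G : R -> R,
     mixing_density h ->
     is_laplace_transform (laplace_density k h) G ->
     minimaxity_condition k G ->
     minimax (@bayes_estimator R k h))
  /\
  (forall (phi : R -> R) (a : R) (b : \bar R),
     {in `]0, +oo[, continuous phi} ->
     (forall s : R, 0 < s -> phi s <= k%:R / s) ->
     (-oo < b)%E ->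
     squared_primitive_defined phi a b ->
     let G := squared_primitive phi a b in
     [/\ forall s : R, 0 < s ->
           [/\ derivable G s 1, derivable G^`()%classic s 1 &
               s%:E <> b -> G s <> 0 /\ G^`()%classic s <> 0],
         minimaxity_condition k G &
         forall f : R -> R,
           (forall t : R, 0 < t -> 0 <= f t) ->
           (forall t : R, 1 <= t -> f t = 0) ->
           is_laplace_transform f G ->
           let h := mixing_of_laplace_density k f in
           [/\ mixing_density h,
               is_laplace_transform (laplace_density k h) G,
               forall h' : R -> R,
                 mixing_density h' ->
                 is_laplace_transform (laplace_density k h') G ->
                 {ae lebesgue_measure, forall v : R, 0 < v -> h' v = h v} &
               lebesgue_measure.-integrable `]0, +oo[ (EFin \o h) ->
               @proper_prior R k h /\ minimax (@bayes_estimator R k h)]]).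
Proof.
split; first by move=> h G; exact: bayes_estimator_minimax.
move=> phi a b phi_cont phi_le bNy def G.
have dG := squared_primitive_derivable phi_cont bNy def.
have cond := squared_primitive_minimaxity_condition phi_cont phi_le bNy def.
split=> // f f0 f1 LG h.
have [intf GL] := is_laplace_transform01 f1 LG.
have f0' t : `]0, 1[%classic t -> 0 <= f t.
  by rewrite /= in_itv/= => /andP[/f0].
have If : (0 < \int[lebesgue_measure]_(t in `]0%R, 1%R[) (f t)%:E)%E.
  (* At any positive [s] other than [b] the value [G s] is nonzero, and one of [1] and [2] differs
     from [b]. *)
  have [s s0 sb] : exists2 s : R, 0 < s & s%:E <> b.
    have [b1|b1] := eqVneq 1%:E b; last by exists 1 => //; exact/eqP.
    by exists 2 => //; rewrite -b1 => -[]; lra.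
  have [_ _ /(_ sb) [Gs _]] := dG s s0.
  rewrite lt0e integral_ge0 ?andbT; last by move=> t It; rewrite lee_fin f0'.
  apply/eqP => If0; apply: Gs; rewrite -/G GL//; apply/le_anti/andP; split.
    apply: le_trans (laplace01_le_integral s intf f0') _.
    by rewrite /Rintegral If0 mulr0.
  by apply: Rintegral_ge0 => t It; rewrite mulr_ge0 ?expR_ge0 ?f0'.
have mf : measurable_fun (`]0, 1[ : set R) f.
  by apply/measurable_EFinP; exact: measurable_int intf.
have hmix : mixing_density h by exact: mixing_density_of_laplace.
have hLG : is_laplace_transform (laplace_density k h) G.
  exact: is_laplace_transform_mixing.
split=> //.
- move=> h' [mh' _ _] LG'.
  have [int1 G1] := is_laplace_transform01 (@laplace_density_ge1 _ k h) hLG.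
  have [int2 G2] := is_laplace_transform01 (@laplace_density_ge1 _ k h') LG'.
  have [mh _ _] := hmix.
  apply: (@mixing_density_ae_unique _ k) => //; apply: laplace01_inj => // s s0.
  by rewrite -G1// -G2.
- move=> inth; have [mh h0 Ih] := hmix; split.
    rewrite /proper_prior integral_mixture_prior// Ih/=.
    by have /integrable_lty := inth; apply; exact: measurable_itv.
  exact: bayes_estimator_minimax hLG cond.
Qed.
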